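(* Let $a_0,a_1,b_0,b_1\in\mathcal A$ and let $w\in\mathbb C$ be a constant. Consider the fourth-order ODE on $\mathbb R$ $$\sum_{i=0}^{2}\binom{2}{i}\left(a_0^{(i)}*\phi^{(4-i)}+\phi^{(4-i)}*a_1^{(i)}\right)-w^2\left(b_0*\phi+\phi*b_1\right)=0,\qquad (E)$$ and let $I$ be its singular set. Assume that: (C1') $a_0(\xi^-)+a_1(\xi^+)\neq 0$ for all $\xi\in I$; (C2') for every regular open interval $\Omega$ of (E), $a_{0\overline{\Omega}}(x)+a_{1\overline{\Omega}}(x)\neq 0$ for all $x\in\overline{\Omega}$. Let $M=\max\{\operatorname{ord} a_i'',\ \operatorname{ord} b_i:\ i=0,1\}$. Then: (i) if $M\le 4$, every solution $\phi$ of (E) satisfies $\operatorname{ord}\phi=0$, and hence $\phi\in\mathcal C_p^\infty$; (ii) if $M>4$, every solution $\phi$ of (E) satisfies $\operatorname{ord}\phi\le M-4$.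
   Context: All functions and distributions are complex valued and all derivatives are distributional. $\mathcal D'$ is the space of Schwartz distributions on $\mathbb R$; locally integrable functions are identified with the associated regular distributions. $\mathcal C_p^\infty$ is the space of functions on $\mathbb R$ that are smooth except on a finite set of points, where they and all their derivatives have finite left and right limits. $\mathcal A\subset\mathcal D'$ is the space of all functions in $\mathcal C_p^\infty$, regarded as distributions, together with all their distributional derivatives of all orders. Equivalently, $F\in\mathcal A$ iff there are points $x_1<\dots<x_m$ such that, with $x_0=-\infty$, $x_{m+1}=+\infty$, $\Omega_i=(x_i,x_{i+1})$ and $\chi_{\Omega_i}$ the characteristic function of $\Omega_i$, $F=\sum_{i=1}^m\sum_{j=0}^n c_{ij}\delta^{(j)}_{x_i}+\sum_{i=0}^m f_i\chi_{\Omega_i}$ with $c_{ij}\in\mathbb C$ and $f_i\in\mathcal C^\infty(\mathbb R)$. Here $\delta_{x_i}$ is the Dirac measure at $x_i$. Product $*$: for $F,G\in\mathcal A$, $F*G=\lim_{\epsilon\downarrow0}F(x)\cdot G(x+\epsilon)$ in the distributional sense, where for small $\epsilon>0$ the two factors have disjoint singular supports and $\cdot$ is the Hörmander product (locally, the product of a distribution by a smooth function). Explicitly, if $F=\sum_{i=1}^m\sum_{j=0}^n a_{ij}\delta^{(j)}_{x_i}+\sum_{i=0}^m f_i\chi_{\Omega_i}$ and $G=\sum_{i=1}^m\sum_{j=0}^n b_{ij}\delta^{(j)}_{x_i}+\sum_{i=0}^m g_i\chi_{\Omega_i}$ (same points for both, $f_i,g_i\in\mathcal C^\infty(\mathbb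 R)$), then $$F*G=\sum_{i=1}^m\sum_{j=0}^n\left[a_{ij}g_i+b_{ij}f_{i-1}\right]\delta^{(j)}_{x_i}+\sum_{i=0}^m f_ig_i\chi_{\Omega_i}\in\mathcal A .$$ Order: $\operatorname{ord}F=n$ iff $F$ is the $n$th distributional derivative, but not a lower order distributional derivative, of a regular distribution; so $\operatorname{ord}F=0$ iff $F$ is regular, and $\operatorname{ord}\delta^{(j)}_{x_0}=j+1$. Singular set: the union $I$ of the singular supports of all the coefficients of the ODE, i.e. of $a_i^{(j)}$ ($j=0,1,2$) and $w^2b_i$, $i=0,1$. A point of $\mathbb R\setminus I$ is regular, and an interval is regular iff all its points are regular. For a regular open interval $\Omega$, $a_{i\overline\Omega}$ denotes the $\mathcal C^\infty(\overline\Omega)$ extension of the restriction $a_i|_\Omega$ to the closure $\overline\Omega$. For $F\in\mathcal A$, $F(\xi^\pm)$ denotes the right/left limit at $\xi$ of the smooth function that $F$ coincides with immediately to the right/left of $\xi$. A solution of the ODE is a $\phi\in\mathcal A$ satisfying it in the sense of distributions on $\mathbb R$. *)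

(* Defs.v *)
From HB Require Import structures.
From mathcomp Require Import all_boot all_order all_algebra.
From mathcomp Require Import all_classical all_reals all_analysis.
From mathcomp Require Import complex.
Set Implicit Arguments.
Unset Strict Implicit.
Unset Printing Implicit Defensive.
Import Order.TTheory GRing.Theory Num.Theory.
Import numFieldNormedType.Exports.
Local Open Scope ring_scope.
Local Open Scope complex_scope.
Local Open Scope classical_set_scope.

(* Limits, derivatives and integrals of functions R -> R[i] are taken
   componentwise: R[i] has no normed R-module structure in the library. *)

Section ComplexCalculus.
Variable R : realType.
Implicit Types (f : R -> R[i]) (U : set R).

Definition reC f : R -> R := fun x => complex.Re (f x).
Definition imC f : R -> R := fun x => complex.Im (f x).

Definition cvgC f (Fl : set_system R) (l : R[i]) : Prop :=
  (reC f x @[x --> Fl] --> complex.Re l) /\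
  (imC f x @[x --> Fl] --> complex.Im l).

Definition derivC n f : R -> R[i] := fun x => (reC f)^`(n) x +i* (imC f)^`(n) x.

Definition smooth_on U f : Prop :=
  forall n x, U x ->
    derivable ((reC f)^`(n)) x 1 /\ derivable ((imC f)^`(n)) x 1.

Definition integralC f : R[i] :=
  (\int[lebesgue_measure]_(x in [set: R]) reC f x) +i*
  (\int[lebesgue_measure]_(x in [set: R]) imC f x).

Definition locally_integrableC f : Prop :=
  locally_integrable [set: R] (reC f) /\ locally_integrable [set: R] (imC f).

Definition supp f : set R := closure [set x | f x != 0].

Definition test_function : set (R -> R[i]^o) :=
  [set t | smooth_on [set: R] t /\ compact (supp t)].

End ComplexCalculus.

Section SmoothLemmas.
Variable R : realType.
Implicit Types g h : R -> R.

Let rsmooth g := forall n x, derivable (g^`(n)) x 1.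

Lemma derive1nD g h n : rsmooth g -> rsmooth h ->
  (g \+ h)^`(n) = g^`(n) \+ h^`(n).
Proof.
move=> sg sh; elim: n => // n IH; rewrite !derive1nS IH.
apply/funext => x; by rewrite /= !derive1E deriveD.
Qed.

Lemma derive1nZ (k : R) g n : rsmooth g -> (k \*: g)^`(n) = k \*: g^`(n).
Proof.
move=> sg; elim: n => // n IH; rewrite !derive1nS IH.
apply/funext => x; by rewrite /= !derive1E deriveZ.
Qed.

Lemma rsmoothD g h : rsmooth g -> rsmooth h -> rsmooth (g \+ h).
Proof.
move=> sg sh n x; by rewrite derive1nD //; apply: derivableD.
Qed.

Lemma rsmoothZ (k : R) g : rsmooth g -> rsmooth (k \*: g).
Proof. move=> sg n x; by rewrite derive1nZ //; apply: derivableZ. Qed.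

Lemma derive1n0f n : (fun _ : R => 0 : R)^`(n) = fun _ => 0.
Proof.
elim: n => // n IH; rewrite derive1nS IH.
by apply/funext => x; rewrite derive1E; exact: derive_cst.
Qed.

Lemma rsmooth0 : rsmooth (fun _ => 0).
Proof. by move=> n x; rewrite derive1n0f; have := derivable_cst (0 : R) x 1. Qed.

Lemma rsmooth_derive1 g : rsmooth g -> rsmooth (g^`()).
Proof. by move=> sg n x; rewrite -derive1Sn; exact: sg. Qed.

Lemma derive1_translate g (e : R) :
  (fun x => g (x - e))^`() = fun x => g^`() (x - e).
Proof.
apply/funext => x; rewrite /derive1.
set u := fun _ => _; set v := fun _ => _; suff -> : u = v by [].
by apply/funext => y; rewrite /u /v /= addrA.
Qed.

Lemma derive1n_translate g (e : R) n :
  (fun x => g (x - e))^`(n) = fun x => g^`(n) (x - e).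
Proof.
by elim: n => // n IH; rewrite !derive1nS IH derive1_translate.
Qed.

Lemma rsmooth_translate g (e : R) : rsmooth g -> rsmooth (fun x => g (x - e)).
Proof.
move=> sg n x; rewrite derive1n_translate.
have := sg n (x - e); rewrite /derivable.
set u := (u in cvg (u @ _) -> _); set v := (v in _ -> cvg (v @ _)).
suff -> : u = v by [].
by apply/funext => y; rewrite /u /v /= addrA.
Qed.

End SmoothLemmas.

Section TestFunctions.
Variable R : realType.
Implicit Types t u : R -> R[i]^o.

Lemma smoothP t : smooth_on [set: R] t <->
  (forall n x, derivable ((reC t)^`(n)) x 1) /\
  (forall n x, derivable ((imC t)^`(n)) x 1).
Proof.
split=> [st|[st1 st2] n x _]; last by split.
by split=> n x; have [] := st n x Logic.I.
Qed.

Lemma derivC1_supp t : supp (derivC 1 t) `<=` supp t.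
Proof.
have -> : supp t = closure (supp t) by apply/closure_id; exact: closed_closure.
apply: closureS => x /=; apply: contra_neqP => xt.
have /= nx : \forall y \near x, t y = 0.
  have : open (~` supp t) by rewrite openC; exact: closed_closure.
  rewrite openE => /(_ x xt); apply: filterS => y yt.
  apply: contra_notP yt => /eqP yt; exact: subset_closure.
have d0 (p : R[i] -> R) : p 0 = 0 -> (fun y => p (t y))^`() x = 0.
  move=> p0; rewrite derive1E.
  rewrite (@near_eq_derive R R R _ (cst 0) x 1) ?derive_cst //.
  by apply: filterS nx => y ->.
by rewrite /derivC !derive1n1 (d0 (@complex.Re R)) // (d0 (@complex.Im R)).
Qed.

Lemma test_function_derive t : test_function t -> test_function (derivC 1 t).
Proof.
move=> [/smoothP[st1 st2] ct]; split; last first.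
  by apply: (subclosed_compact _ ct (@derivC1_supp t)); exact: closed_closure.
by apply/smoothP; split; exact: rsmooth_derive1.
Qed.

Lemma test_function_translate (e : R) t :
  test_function t -> test_function (fun x => t (x - e)).
Proof.
move=> [/smoothP[st1 st2] ct]; split.
  apply/smoothP; split.
    exact: (@rsmooth_translate _ (reC t) e).
  exact: (@rsmooth_translate _ (imC t) e).
have cs : compact ((fun x : R => x + e) @` supp t).
  apply: continuous_compact => //.
  have : continuous (fun x : R => x + e).
    by move=> x; exact: (cvgD cvg_id (cvg_cst e)).
  exact: continuous_subspaceT.
apply: (subclosed_compact _ cs); first exact: closed_closure.
rewrite [X in _ `<=` X](closure_id _).1; last first.
  by apply: compact_closed => //; exact: norm_hausdorff.
apply: closureS => x /= tx.
by exists (x - e); [exact: subset_closure|rewrite subrK].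
Qed.

Definition test_function_pred : {pred (R -> R[i]^o)} := mem (@test_function R).

Lemma test_function_submod_closed : submod_closed test_function_pred.
Proof.
split=> [|a t u]; rewrite !inE /test_function/=.
  split; first by apply/smoothP; split; exact: rsmooth0.
  rewrite /supp (_ : [set _ | _] = set0) ?closure0; first exact: compact0.
  by rewrite -subset0 => x /=; rewrite eqxx.
move=> [/smoothP[st1 st2] ct] [/smoothP[su1 su2] cu]; split.
  have reM (p q r : R[i]) : complex.Re (p * q + r) =
      complex.Re p * complex.Re q + (- complex.Im p) * complex.Im q + complex.Re r.
    by case: p q r => [? ?] [? ?] [? ?]; rewrite /= mulNr.
  have imM (p q r : R[i]) : complex.Im (p * q + r) =
      complex.Re p * complex.Im q + complex.Im p * complex.Re q + complex.Im r.
    by case: p q r => [? ?] [? ?] [? ?].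
  have reE : reC (a *: t + u) =
      (complex.Re a \*: reC t \+ (- complex.Im a) \*: imC t) \+ reC u.
    by apply/funext => x; exact: reM.
  have imE : imC (a *: t + u) =
      (complex.Re a \*: imC t \+ complex.Im a \*: reC t) \+ imC u.
    by apply/funext => x; exact: imM.
  apply/smoothP; split.
    rewrite reE; exact: rsmoothD (rsmoothD (rsmoothZ st1) (rsmoothZ st2)) su1.
  rewrite imE; exact: rsmoothD (rsmoothD (rsmoothZ st2) (rsmoothZ st1)) su2.
apply: (subclosed_compact _ (compactU ct cu)); first exact: closed_closure.
rewrite /supp -closureU; apply: closureS => x /=; apply: contra_neqP => /not_orP.
move=> [/negP/negPn/eqP tx /negP/negPn/eqP ux].
by rewrite -[LHS]/(a *: t x + u x) tx ux scaler0 addr0.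
Qed.

HB.instance Definition _ :=
  GRing.isSubmodClosed.Build R[i] (R -> R[i]^o) test_function_pred
    test_function_submod_closed.

Record testfun := Testfun {
  tfun :> R -> R[i]^o;
  testfunP : tfun \in test_function_pred }.

HB.instance Definition _ := [isSub for tfun].
HB.instance Definition _ := [Choice of testfun by <:].
HB.instance Definition _ := [SubChoice_isSubLmodule of testfun by <:].

Definition test_derive (t : testfun) : testfun :=
  Testfun (mem_set (test_function_derive (set_mem (testfunP t)))).

Definition test_translate (e : R) (t : testfun) : testfun :=
  Testfun (mem_set (test_function_translate e (set_mem (testfunP t)))).

End TestFunctions.

Section Distributions.
Variable R : realType.

Definition functional := testfun R -> R[i]^o.
Implicit Types (F G H : functional) (f : R -> R[i]) (U : set R).

(* Hoermander's seminorm estimate, with a common bound B of the derivatives of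
   order at most N in place of their suprema. *)
Definition is_distribution F : Prop :=
  linear F /\
  forall K : set R, compact K -> exists (N : nat) (c : R),
    forall (t : testfun R) (B : R), supp t `<=` K ->
      (forall n x, (n <= N)%N -> Normc.normc (derivC n t x) <= B) ->
      Normc.normc (F t) <= c * B.

Definition regular f : functional := fun t => integralC (fun x => f x * t x).

Definition Ddist F : functional := fun t => - F (test_derive t).

Definition Dn (n : nat) F : functional := iter n Ddist F.

(* The distribution F(x + e). *)
Definition translate (e : R) F : functional := fun t => F (test_translate e t).

(* agree_on U F (regular f) only involves the values of f on U. *)
Definition agree_on U F G : Prop :=
  forall t : testfun R, supp t `<=` U -> F t = G t.

Definition sing_supp F : set R :=
  [set x | ~ exists (U : set R) f,
     [/\ open_nbhs x U, smooth_on U f & agree_on U F (regular f)]].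

Definition piecewise_smooth f : Prop :=
  exists s : seq R, smooth_on [set x | x \notin s] f /\
    forall (n : nat) (xi : R), xi \in s ->
      (exists l, cvgC (derivC n f) xi^'- l) /\
      (exists l, cvgC (derivC n f) xi^'+ l).

Definition classA : set functional :=
  [set F | exists f n, piecewise_smooth f /\ F = Dn n (regular f)].

(* P = f G on U, where f is smooth on U: P(t) = G(f t).  For supp t `<=` U the
   function f t, being zero off supp t, is a test function on the line, whatever
   the values of f outside U. *)
Definition eq_smooth_mul U f G P : Prop :=
  forall t s : testfun R, supp t `<=` U -> (forall x, s x = f x * t x) ->
    P t = G s.

Definition is_hormander_product F G P : Prop :=
  is_distribution P /\
  forall x : R, exists (U : set R) f, [/\ open_nbhs x U, smooth_on U f &
    (agree_on U F (regular f) /\ eq_smooth_mul U f G P) \/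
    (agree_on U G (regular f) /\ eq_smooth_mul U f F P)].

Definition is_star F G H : Prop :=
  is_distribution H /\
  exists P : R -> functional,
    (\forall e \near 0^'+, is_hormander_product F (translate e G) (P e)) /\
    forall t, cvgC (fun e => P e t) 0^'+ (H t).

(* Both the existence and the uniqueness of H hold for F, G in classA; the value
   0 in the absence of H is a convention. *)
Definition star F G : functional := xget (0 : functional) [set H | is_star F G H].

Definition is_derivative_of_regular (n : nat) F : Prop :=
  exists f, locally_integrableC f /\ F = Dn n (regular f).

(* ord F = n *)
Definition has_ord F (n : nat) : Prop :=
  is_derivative_of_regular n F /\
  forall m, (m < n)%N -> ~ is_derivative_of_regular m F.

(* F(xi^-) and F(xi^+) *)
Definition left_value F (xi : R) : R[i] :=
  xget 0 [set v | exists a f, [/\ a < xi, smooth_on `]a, xi[ f,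
    agree_on `]a, xi[ F (regular f) & cvgC f xi^'- v]].

Definition right_value F (xi : R) : R[i] :=
  xget 0 [set v | exists b f, [/\ xi < b, smooth_on `]xi, b[ f,
    agree_on `]xi, b[ F (regular f) & cvgC f xi^'+ v]].

(* f restricted to closure U is the smooth function on closure U that extends
   F restricted to U; smoothness up to the boundary means that all derivatives
   have finite limits at the boundary points of U. *)
Definition is_smooth_extension F U f : Prop :=
  [/\ smooth_on U f, agree_on U F (regular f),
      (forall x, closure U x -> cvgC f (within U (nbhs x)) (f x)) &
      forall (n : nat) x, closure U x ->
        exists l, cvgC (derivC n f) (within U (nbhs x)) l].

(* Only the values on closure U are determined by F and U. *)
Definition smooth_extension F U : R -> R[i]^o :=
  xget 0 [set f | is_smooth_extension F U f].

End Distributions.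

Section FourthOrderODE.
Variable R : realType.
Variables (a0 a1 b0 b1 : functional R) (w : R[i]).

Local Notation "F ** G" := (star F G) (at level 40).

Definition ode_lhs (phi : functional R) : functional R :=
  \sum_(i < 3) ('C(2, i)%:R : R[i]) *:
     ((Dn i a0 ** Dn (4 - i) phi) + (Dn (4 - i) phi ** Dn i a1))
  - w ^+ 2 *: ((b0 ** phi) + (phi ** b1)).

Definition is_solution (phi : functional R) : Prop :=
  classA phi /\ ode_lhs phi = 0.

Definition singular_set : set R :=
  [set x | (exists j : 'I_3, sing_supp (Dn j a0) x \/ sing_supp (Dn j a1) x) \/
           sing_supp (w ^+ 2 *: b0) x \/ sing_supp (w ^+ 2 *: b1) x].

Definition regular_open_interval (U : set R) : Prop :=
  [/\ open U, is_interval U, U !=set0 & U `<=` ~` singular_set].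

End FourthOrderODE.

(* Main.v *)
Require Import Defs.
From HB Require Import structures.
From mathcomp Require Import all_boot all_order all_algebra.
From mathcomp Require Import all_classical all_reals all_analysis.
From mathcomp Require Import measurable_realfun complex ring lra zify.
(* Defs again: poly.v has another derivC. *)
Import Defs.
Set Implicit Arguments.
Unset Strict Implicit.
Unset Printing Implicit Defensive.
Import Order.TTheory GRing.Theory Num.Theory.
Import numFieldNormedType.Exports.
Local Open Scope ring_scope.
Local Open Scope complex_scope.
Local Open Scope classical_set_scope.

(* Every element of classA is D^n f with f piecewise smooth, and integrating by
   parts on each piece puts it in the normal form
     g + sum_{x, j} c(x, j) t^(j)(x),   g = f^(n),
   where c(x, j) is (-1)^j times the jump at x of the derivative of f of order
   n - 1 - j.  For F and G in normal form the Hoermander product of F(x) and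
   G(x + e) is explicit and unique for small e > 0, so that F * G has the normal
   form given by the Leibniz rule with the one-sided limits of the smooth parts.
   Coefficients are read off by testing against r^k T((y - xi) / r) as r -> 0,
   where T^(j)(0) = [j = k]; the same tests show that a p-th derivative of a
   locally integrable function has no coefficient of order >= p.

   Write a solution as phi = D^N f with f piecewise smooth, N > 0 and N + 4 > M.
   At order N + 3 only a0 * phi'''' and phi'''' * a1 contribute to the
   coefficient at xi of the equation, which is therefore, up to sign,
   jump f xi * (a0(xi-) + a1(xi+)).  Hence f has no jump, D f is the function f',
   and phi = D^(N-1) f'; iterating, N drops to max(0, M - 4). *)

(** * Calculus of complex-valued functions *)

(** The equation is never solved: it is used only through one coefficient at one point, and the
    descent is on the number of derivatives in one representation of the solution. Conditions (C1')
    and (C2') are both called upon because [f] may a priori jump at any point of the line: at a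
    regular point, (C2') on a small interval around it provides the nonzero factor that (C1')
    provides on I. Nothing else reaches order N + 3. Each a_i'' has no coefficient of order N + 3 or
    more, hence neither have a_i and a_i', since differentiation raises orders by one. The
    derivatives phi''' and phi'' stop at orders N + 2 and N + 1, and the Leibniz rule never raises
    the order of a coefficient. Two obstacles shape the proof. The product and the one-sided values
    are chosen by [xget] among all objects with a property, so every explicit formula needs
    uniqueness, obtained by gluing local identities and from the fundamental lemma of the calculus
    of variations. And orders refer to arbitrary locally integrable functions, which have no normal
    form; coefficients are therefore compared through limits of tests, which send such functions to
    0. *)

Section ComplexLimits.
Variable R : realType.

(** Convertible to [cvgC] on filters of the line; the arbitrary domain also covers limits along
    sequences. *)
Definition ccvg {T : Type} (Fl : set_system T) (u : T -> R[i]) (l : R[i]) : Prop :=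
  (complex.Re (u x) @[x --> Fl] --> complex.Re l) /\
  (complex.Im (u x) @[x --> Fl] --> complex.Im l).

Lemma complex_ReIm (a b : R[i]) : complex.Re a = complex.Re b ->
  complex.Im a = complex.Im b -> a = b.
Proof. by case: a b => [a1 a2] [b1 b2] /= -> ->. Qed.

Lemma cReD (a b : R[i]) : complex.Re (a + b) = complex.Re a + complex.Re b.
Proof. by case: a b => [? ?] [? ?]. Qed.

Lemma cImD (a b : R[i]) : complex.Im (a + b) = complex.Im a + complex.Im b.
Proof. by case: a b => [? ?] [? ?]. Qed.

Lemma cReN (a : R[i]) : complex.Re (- a) = - complex.Re a.
Proof. by case: a. Qed.

Lemma cImN (a : R[i]) : complex.Im (- a) = - complex.Im a.
Proof. by case: a. Qed.

Lemma cReM (a b : R[i]) : complex.Re (a * b) =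
  complex.Re a * complex.Re b - complex.Im a * complex.Im b.
Proof. by case: a b => [? ?] [? ?]. Qed.

Lemma cImM (a b : R[i]) : complex.Im (a * b) =
  complex.Re a * complex.Im b + complex.Im a * complex.Re b.
Proof. by case: a b => [? ?] [? ?]. Qed.

Lemma ccvg_cst T (Fl : set_system T) {FF : Filter Fl} (l : R[i]) :
  ccvg Fl (fun=> l) l.
Proof. by split; exact: cvg_cst. Qed.

Lemma ccvgD T (Fl : set_system T) {FF : Filter Fl} u v (a b : R[i]) :
  ccvg Fl u a -> ccvg Fl v b -> ccvg Fl (fun x => u x + v x) (a + b).
Proof.
move=> [u1 u2] [v1 v2]; split.
  by rewrite cReD; under eq_fun do rewrite cReD; apply: cvgD.
by rewrite cImD; under eq_fun do rewrite cImD; apply: cvgD.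
Qed.

Lemma ccvgM T (Fl : set_system T) {FF : Filter Fl} u v (a b : R[i]) :
  ccvg Fl u a -> ccvg Fl v b -> ccvg Fl (fun x => u x * v x) (a * b).
Proof.
move=> [u1 u2] [v1 v2]; split.
  by rewrite cReM; under eq_fun do rewrite cReM; apply: cvgB; apply: cvgM.
by rewrite cImM; under eq_fun do rewrite cImM; apply: cvgD; apply: cvgM.
Qed.

Lemma ccvgN T (Fl : set_system T) {FF : Filter Fl} u (a : R[i]) :
  ccvg Fl u a -> ccvg Fl (fun x => - u x) (- a).
Proof.
move=> [u1 u2]; split.
  by rewrite cReN; under eq_fun do rewrite cReN; apply: cvgN.
by rewrite cImN; under eq_fun do rewrite cImN; apply: cvgN.
Qed.

Lemma ccvg_sum T (Fl : set_system T) {FF : Filter Fl} (I : eqType) (r : seq I)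
    (u : I -> T -> R[i]) (a : I -> R[i]) :
  (forall i, i \in r -> ccvg Fl (u i) (a i)) ->
  ccvg Fl (fun x => \sum_(i <- r) u i x) (\sum_(i <- r) a i).
Proof.
elim: r => [_|i r IH h].
  by rewrite big_nil; under eq_fun do rewrite big_nil; exact: ccvg_cst.
rewrite big_cons; under eq_fun do rewrite big_cons.
apply: ccvgD; first by apply: h; rewrite mem_head.
by apply: IH => j jr; apply: h; rewrite in_cons jr orbT.
Qed.

Lemma ccvg_unique T (Fl : set_system T) {FF : ProperFilter Fl} u (a b : R[i]) :
  ccvg Fl u a -> ccvg Fl u b -> a = b.
Proof.
move=> [u1 u2] [v1 v2].
apply: complex_ReIm.
  exact: (cvg_unique _ u1 v1).
exact: (cvg_unique _ u2 v2).
Qed.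

Lemma ccvg_near T (Fl : set_system T) {FF : Filter Fl} u v (a : R[i]) :
  (\forall x \near Fl, u x = v x) -> ccvg Fl u a -> ccvg Fl v a.
Proof.
move=> uv [u1 u2]; split.
  apply: cvg_trans u1; apply: near_eq_cvg; apply: filterS uv => x /= -> //.
apply: cvg_trans u2; apply: near_eq_cvg; apply: filterS uv => x /= -> //.
Qed.

Lemma ccvg_comp T U (Fl : set_system T) (Gl : set_system U) (h : T -> U)
    (u : U -> R[i]) (a : R[i]) :
  h @ Fl --> Gl -> ccvg Gl u a -> ccvg Fl (u \o h) a.
Proof. by move=> hFG [u1 u2]; split; [exact: (cvg_comp _ _ hFG u1)|exact: (cvg_comp _ _ hFG u2)]. Qed.

End ComplexLimits.

Section ComplexDerivatives.
Variable R : realType.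
Implicit Types (f g : R -> R[i]) (U : set R) (x : R).

Definition cdable f x := derivable (reC f) x 1 /\ derivable (imC f) x 1.

Lemma smooth_onE U f : smooth_on U f <-> forall n x, U x -> cdable (derivC n f) x.
Proof. by []. Qed.

Lemma derivC0 f : derivC 0 f = f.
Proof. by apply/funext => x; rewrite /derivC /=; apply: complex_ReIm. Qed.

Lemma derivCS n f : derivC n.+1 f = derivC 1 (derivC n f).
Proof. by []. Qed.

Lemma derivCD n m f : derivC n (derivC m f) = derivC (n + m) f.
Proof. by elim: n => [|n IH]; rewrite ?derivC0 // (derivCS n (derivC m f)) IH. Qed.

Lemma near_eq_cdable f g x : (\forall y \near x, f y = g y) ->
  cdable f x -> cdable g x.
Proof.
move=> fg [f1 f2]; split.
  by apply: near_eq_derivable f1; apply: filterS fg => y; rewrite /reC => ->.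
by apply: near_eq_derivable f2; apply: filterS fg => y; rewrite /imC => ->.
Qed.

Lemma near_eq_derivC1 f g x : (\forall y \near x, f y = g y) ->
  derivC 1 f x = derivC 1 g x.
Proof.
move=> fg; rewrite /derivC !derive1n1 !derive1E.
congr (_ +i* _); apply: near_eq_derive;
  by apply: filterS fg => y; rewrite /reC /imC => ->.
Qed.

Lemma near_eq_derivC n f g x : (\forall y \near x, f y = g y) ->
  (\forall y \near x, derivC n f y = derivC n g y).
Proof.
elim: n => [|n IH] fg; first by rewrite !derivC0.
have /nbhs_interior := IH fg; rewrite (derivCS n f) (derivCS n g).
by apply: filterS => y /= ?; exact: near_eq_derivC1.
Qed.

Lemma near_eq_derivC_at n f g x : (\forall y \near x, f y = g y) ->
  derivC n f x = derivC n g x.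
Proof. by move=> /(near_eq_derivC n)/nbhs_singleton. Qed.

Lemma cdableM f g x : cdable f x -> cdable g x -> cdable (fun y => f y * g y) x.
Proof.
move=> [f1 f2] [g1 g2]; split.
  have -> : reC (fun y => f y * g y) = reC f * reC g - imC f * imC g.
    by apply/funext => y; rewrite /reC cReM.
  exact: (derivableB (derivableM f1 g1) (derivableM f2 g2)).
have -> : imC (fun y => f y * g y) = reC f * imC g + imC f * reC g.
  by apply/funext => y; rewrite /imC cImM.
exact: (derivableD (derivableM f1 g2) (derivableM f2 g1)).
Qed.

Lemma derivC1M f g x : cdable f x -> cdable g x ->
  derivC 1 (fun y => f y * g y) x = derivC 1 f x * g x + f x * derivC 1 g x.
Proof.
move=> [f1 f2] [g1 g2]; apply: complex_ReIm.
  rewrite cReD !cReM /derivC !derive1n1 !derive1E /=.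
  have -> : reC (fun y => f y * g y) = reC f * reC g - imC f * imC g.
    by apply/funext => y; rewrite /reC cReM.
  rewrite (deriveB (derivableM f1 g1) (derivableM f2 g2)).
  rewrite (deriveM f1 g1) (deriveM f2 g2) /GRing.scale /=.
move: ('D_1 (reC f) x) ('D_1 (imC f) x) ('D_1 (reC g) x) ('D_1 (imC g) x).
by rewrite /reC /imC => *; ring.
rewrite cImD !cImM /derivC !derive1n1 !derive1E /=.
have -> : imC (fun y => f y * g y) = reC f * imC g + imC f * reC g.
  by apply/funext => y; rewrite /imC cImM.
rewrite (deriveD (derivableM f1 g2) (derivableM f2 g1)).
rewrite (deriveM f1 g2) (deriveM f2 g1) /GRing.scale /=.
move: ('D_1 (reC f) x) ('D_1 (imC f) x) ('D_1 (reC g) x) ('D_1 (imC g) x).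
by rewrite /reC /imC => *; ring.
Qed.

Lemma cdableD f g x : cdable f x -> cdable g x -> cdable (fun y => f y + g y) x.
Proof.
move=> [f1 f2] [g1 g2]; split.
  have -> : reC (fun y => f y + g y) = reC f + reC g.
    by apply/funext => y; rewrite /reC cReD.
  exact: (derivableD f1 g1).
have -> : imC (fun y => f y + g y) = imC f + imC g.
  by apply/funext => y; rewrite /imC cImD.
exact: (derivableD f2 g2).
Qed.

Lemma derivC1D f g x : cdable f x -> cdable g x ->
  derivC 1 (fun y => f y + g y) x = derivC 1 f x + derivC 1 g x.
Proof.
move=> [f1 f2] [g1 g2]; apply: complex_ReIm.
  rewrite cReD /derivC !derive1n1 !derive1E /=.
  have -> : reC (fun y => f y + g y) = reC f + reC g.
    by apply/funext => y; rewrite /reC cReD.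
  by rewrite (deriveD f1 g1).
rewrite cImD /derivC !derive1n1 !derive1E /=.
have -> : imC (fun y => f y + g y) = imC f + imC g.
  by apply/funext => y; rewrite /imC cImD.
by rewrite (deriveD f2 g2).
Qed.

Lemma cdable_cst (c : R[i]) x : cdable (fun=> c) x.
Proof. split; exact: derivable_cst. Qed.

Lemma derivC1_cst (c : R[i]) x : derivC 1 (fun=> c) x = 0.
Proof. by rewrite /derivC !derive1n1 !derive1E !derive_cst. Qed.

Lemma cdableZ (c : R[i]) f x : cdable f x -> cdable (fun y => c * f y) x.
Proof. by move=> fx; exact: (cdableM (cdable_cst c x) fx). Qed.

Lemma derivC1Z (c : R[i]) f x : cdable f x ->
  derivC 1 (fun y => c * f y) x = c * derivC 1 f x.
Proof.
by move=> fx; rewrite (derivC1M (cdable_cst c x) fx) derivC1_cst mul0r add0r.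
Qed.

Lemma cdable_sum I (r : seq I) (f : I -> R -> R[i]) x :
  (forall i, cdable (f i) x) -> cdable (fun y => \sum_(i <- r) f i y) x /\
  derivC 1 (fun y => \sum_(i <- r) f i y) x = \sum_(i <- r) derivC 1 (f i) x.
Proof.
move=> fx; elim: r => [|i r [IH1 IH2]].
  under eq_fun do rewrite big_nil; rewrite big_nil.
  by split; [exact: cdable_cst|exact: derivC1_cst].
under eq_fun do rewrite big_cons; rewrite big_cons; split.
  exact: (cdableD (fx i) IH1).
by rewrite (derivC1D (fx i) IH1) IH2.
Qed.

Lemma smooth_on_sub U V f : V `<=` U -> smooth_on U f -> smooth_on V f.
Proof. by move=> VU fU n x /VU; exact: fU. Qed.

Lemma smooth_on_derivC U k f : smooth_on U f -> smooth_on U (derivC k f).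
Proof. by move=> /smooth_onE fU; apply/smooth_onE => n x Ux; rewrite derivCD; apply: fU. Qed.

(** Differentiability and formula are proved together: on the open set [U] the formula of order n
    writes the n-th derivative near [x] as a sum of differentiable products, and differentiating
    that sum gives order n + 1 by Pascal's rule. *)
Lemma leibniz U f g : open U -> smooth_on U f -> smooth_on U g ->
  forall n x, U x -> cdable (derivC n (fun y => f y * g y)) x /\
    derivC n (fun y => f y * g y) x =
    \sum_(k < n.+1) 'C(n, k)%:R * derivC (n - k) f x * derivC k g x.
Proof.
move=> oU /smooth_onE fU /smooth_onE gU.
have main n : (forall x, U x -> derivC n (fun y => f y * g y) x =
    \sum_(k < n.+1) 'C(n, k)%:R * derivC (n - k) f x * derivC k g x) ->
    forall x, U x -> cdable (derivC n (fun y => f y * g y)) x /\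
      derivC n.+1 (fun y => f y * g y) x =
      \sum_(k < n.+1) 'C(n, k)%:R * (derivC (n - k).+1 f x * derivC k g x +
        derivC (n - k) f x * derivC k.+1 g x).
  move=> IH x Ux.
  have nE : \forall y \near x, \sum_(k < n.+1) 'C(n, k)%:R *
      (derivC (n - k) f y * derivC k g y) = derivC n (fun y => f y * g y) y.
    have : nbhs x U by apply: open_nbhs_nbhs.
    apply: filterS => y Uy; rewrite IH //; apply: eq_bigr => k _.
    by rewrite mulrA.
  have dk (k : 'I_n.+1) : cdable (fun y => derivC (n - k) f y * derivC k g y) x.
    by apply: cdableM; [exact: fU|exact: gU].
  have [d1 d2] := @cdable_sum _ (index_enum 'I_n.+1) (fun (k : 'I_n.+1) y => 'C(n, k)%:R *
      (derivC (n - k) f y * derivC k g y)) x (fun k => cdableZ _ (dk k)).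
  split; first exact: near_eq_cdable nE d1.
  rewrite (derivCS n (fun y => f y * g y)) -(near_eq_derivC1 nE) d2; apply: eq_bigr => k _.
  by rewrite (derivC1Z _ (dk k)) (derivC1M (fU _ _ Ux) (gU _ _ Ux)).
have formula n : forall x, U x -> derivC n (fun y => f y * g y) x =
    \sum_(k < n.+1) 'C(n, k)%:R * derivC (n - k) f x * derivC k g x.
  elim: n => [|n IH] x Ux.
    by rewrite big_ord1 !derivC0 bin0 mul1r.
  have [_ ->] := main n IH x Ux.
  under eq_bigr do rewrite mulrDr; rewrite big_split /=.
  rewrite [in RHS]big_ord_recl /= bin0 subn0 mul1r.
  under [in RHS]eq_bigr do rewrite /bump /= add1n binS natrD !mulrDl subSS.
  rewrite big_split /= addrA; congr (_ + _); last first.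
    by apply: eq_bigr => k _; rewrite mulrA.
  rewrite big_ord_recl /= bin0 subn0 mul1r; congr (_ + _).
  rewrite [in RHS]big_ord_recr /= bin_small // !mul0r addr0.
  apply: eq_bigr => k _; rewrite /bump /= add1n mulrA subnSK //.
move=> n x Ux; split; last exact: formula.
by have [] := main n (formula n) x Ux.
Qed.

Lemma smooth_onM U f g : open U -> smooth_on U f -> smooth_on U g ->
  smooth_on U (fun y => f y * g y).
Proof.
by move=> oU fU gU; apply/smooth_onE => n x Ux; have [] := leibniz oU fU gU n Ux.
Qed.

(** A bound [n] common to all [j < n] makes the double sum over [j] and [k] rectangular, so that
    [deltas_smooth_mul] can exchange it. *)
Lemma leibniz_small U f g j n : open U -> smooth_on U f -> smooth_on U g ->
  forall x, U x -> (j < n)%N -> derivC j (fun y => f y * g y) x =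
    \sum_(k < n) 'C(j, k)%:R * derivC (j - k) f x * derivC k g x.
Proof.
move=> oU fU gU x Ux jn; rewrite (leibniz oU fU gU j Ux).2.
rewrite (big_ord_widen n (fun k => 'C(j, k)%:R * derivC (j - k) f x * derivC k g x)) //.
rewrite [in RHS](bigID (fun k : 'I_n => (k < j.+1)%N)) /= [X in _ = _ + X]big1 ?addr0 //.
by move=> k; rewrite -leqNgt => kj; rewrite bin_small // !mul0r.
Qed.

Lemma derivCD_on U f g : open U -> smooth_on U f -> smooth_on U g ->
  forall n x, U x -> cdable (derivC n (fun y => f y + g y)) x /\
    derivC n (fun y => f y + g y) x = derivC n f x + derivC n g x.
Proof.
move=> oU /smooth_onE fU /smooth_onE gU.
have main n : (forall x, U x ->
      derivC n (fun y => f y + g y) x = derivC n f x + derivC n g x) ->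
    forall x, U x -> cdable (derivC n (fun y => f y + g y)) x /\
      derivC n.+1 (fun y => f y + g y) x = derivC n.+1 f x + derivC n.+1 g x.
  move=> IH x Ux.
  have nE : \forall y \near x, derivC n f y + derivC n g y =
      derivC n (fun y => f y + g y) y.
    have : nbhs x U by apply: open_nbhs_nbhs.
    by apply: filterS => y Uy; rewrite IH.
  split; first by apply: near_eq_cdable nE _; apply: cdableD; [exact: fU|exact: gU].
  by rewrite (derivCS n (fun y => f y + g y)) -(near_eq_derivC1 nE) derivC1D //; [exact: fU|exact: gU].
have formula n : forall x, U x ->
    derivC n (fun y => f y + g y) x = derivC n f x + derivC n g x.
  elim: n => [|n IH] x Ux; first by rewrite !derivC0.
  by have [_ ->] := main n IH x Ux.
move=> n x Ux; split; last exact: formula.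
by have [] := main n (formula n) x Ux.
Qed.

Lemma smooth_on_cst U (c : R[i]) : smooth_on U (fun=> c).
Proof.
have h n x : derivC n (fun=> c) x = if n is 0 then c else 0.
  elim: n x => [|n IH] x; first by rewrite derivC0.
  rewrite (derivCS n (fun=> c)) (_ : derivC n (fun=> c) = fun=> if n is 0 then c else 0).
    exact: derivC1_cst.
  by apply/funext => y; exact: IH.
apply/smooth_onE => n x _.
rewrite (_ : derivC n (fun=> c) = fun=> if n is 0 then c else 0).
  exact: cdable_cst.
by apply/funext => y; exact: h.
Qed.

Lemma derivCZ_on U (c : R[i]) f : open U -> smooth_on U f ->
  forall n x, U x -> derivC n (fun y => c * f y) x = c * derivC n f x.
Proof.
move=> oU /smooth_onE fU; elim=> [|n IH] x Ux; first by rewrite !derivC0.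
rewrite (derivCS n f) (derivCS n (fun y => c * f y)) -derivC1Z; last exact: fU.
apply: near_eq_derivC1; have : nbhs x U by apply: open_nbhs_nbhs.
by apply: filterS => y Uy; rewrite IH.
Qed.

Lemma smooth_onZ U (c : R[i]) f : open U -> smooth_on U f -> smooth_on U (fun y => c * f y).
Proof. by move=> oU fU; exact: (smooth_onM oU (@smooth_on_cst U c) fU). Qed.

Lemma smooth_onD U f g : open U -> smooth_on U f -> smooth_on U g ->
  smooth_on U (fun y => f y + g y).
Proof.
by move=> oU fU gU; apply/smooth_onE => n x Ux; have [] := derivCD_on oU fU gU n Ux.
Qed.

Lemma cdable_ccvg f x : cdable f x -> ccvg (nbhs x) f (f x).
Proof.
by move=> [/derivable1_diffP/differentiable_continuous f1
  /derivable1_diffP/differentiable_continuous f2]; split.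
Qed.

Lemma derivC_translate n f (e : R) :
  derivC n (fun x => f (x - e)) = fun x => derivC n f (x - e).
Proof.
apply/funext => x; rewrite /derivC.
by rewrite (derive1n_translate (reC f) e n) (derive1n_translate (imC f) e n).
Qed.

Lemma cdable_translate f (e x : R) : cdable f (x - e) -> cdable (fun y => f (y - e)) x.
Proof.
have tr (g : R -> R) : derivable g (x - e) 1 -> derivable (fun y => g (y - e)) x 1.
  rewrite /derivable.
  set u := (u in cvg (u @ _) -> _); set v := (v in _ -> cvg (v @ _)).
  suff -> : u = v by [].
  by apply/funext => y; rewrite /u /v /= addrA.
by move=> [f1 f2]; split; [exact: (tr (reC f))|exact: (tr (imC f))].
Qed.

Lemma smooth_on_translate U f e : smooth_on U f ->
  smooth_on [set x | U (x - e)] (fun x => f (x - e)).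
Proof.
move=> /smooth_onE fU; apply/smooth_onE => n x /= Ux.
by rewrite derivC_translate; apply: cdable_translate; exact: fU.
Qed.

End ComplexDerivatives.

(** * Cutoff functions and test functions *)

Section FlatFunction.
Variable R : realType.
Implicit Types (x : R).

Definition rC (g : R -> R) : R -> R[i] := fun x => (g x)%:C.

Lemma cdable_rC g x : derivable g x 1 -> cdable (rC g) x.
Proof. by move=> gx; split => //; exact: derivable_cst. Qed.

Lemma derivC1_rC g x : derivC 1 (rC g) x = (derive1 g x)%:C.
Proof. by rewrite /derivC !derive1n1 [X in _ +i* X]derive1E derive_cst. Qed.

(** The powers of [x^-1] make the linear span of the family stable under differentiation, which
    reduces smoothness of exp(-1/x) to one differentiability statement. *)
Definition flat k x : R := if 0 < x then (x^-1) ^+ k * expR (- x^-1) else 0.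

Lemma flat_le0 k x : x <= 0 -> flat k x = 0.
Proof. by move=> x0; rewrite /flat ltNge x0. Qed.

Lemma flat_gt0 k x : 0 < x -> 0 < flat k x.
Proof. by move=> x0; rewrite /flat x0 mulr_gt0 ?expR_gt0 // exprn_gt0 ?invr_gt0. Qed.

Lemma flat_ge0 k x : 0 <= flat k x.
Proof. by case: (leP x 0) => x0; [rewrite flat_le0|exact: ltW (flat_gt0 k x0)]. Qed.

(** From exp(u) >= u with u = 1 / (x (k + 2)), raised to the power k + 2: k of the factors x cancel
    the pole and two remain, enough for a zero derivative at 0. *)
Lemma flat_le k x : flat k x <= k.+2%:R ^+ k.+2 * x ^+ 2.
Proof.
case: (leP x 0) => x0.
  by rewrite flat_le0 // mulr_ge0 ?sqr_ge0 ?exprn_ge0 ?ler0n.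
rewrite /flat x0.
have -> : expR (- x^-1) = expR (- (x^-1 / k.+2%:R)) ^+ k.+2.
  by rewrite -expRM_natl; congr expR; rewrite mulrN mulrCA mulfV ?mulr1 // pnatr_eq0.
have h : expR (- (x^-1 / k.+2%:R)) <= k.+2%:R * x.
  rewrite expRN -[leRHS]invrK lef_pV2 ?posrE ?expR_gt0 ?invr_gt0 ?mulr_gt0 //.
  rewrite invfM mulrC (le_trans _ (expR_ge1Dx _)) // ler_wpDl //.
have h2 : expR (- (x^-1 / k.+2%:R)) ^+ k.+2 <= (k.+2%:R * x) ^+ k.+2.
  by apply: lerXn2r => //; rewrite nnegrE ?expR_ge0 // mulr_ge0 // ltW.
have x0k : 0 <= x^-1 ^+ k by rewrite exprn_ge0 // invr_ge0 ltW.
apply: (le_trans (ler_wpM2l x0k h2)).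
have -> : x^-1 ^+ k * (k.+2%:R * x) ^+ k.+2 = k.+2%:R ^+ k.+2 * x ^+ 2 * (x^-1 * x) ^+ k.
  by rewrite !exprMn -[in x ^+ k.+2](addn2 k) exprD; ring.
by rewrite mulVf ?gt_eqF // expr1n mulr1.
Qed.

Lemma flat_derive k x : derivable (flat k) x 1 /\
  derive1 (flat k) x = - k%:R * flat k.+1 x + flat k.+2 x.
Proof.
have [x0|x0|->] := ltgtP x 0.
- have nE : \forall y \near x, cst 0 y = flat k y.
    have : nbhs x [set y | y < 0] by apply: open_nbhs_nbhs; split => //; exact: open_lt.
    by apply: filterS => y /= /ltW/flat_le0 ->.
  split; first by apply: near_eq_derivable nE _; exact: derivable_cst.
  rewrite derive1E -(near_eq_derive _ nE) derive_cst !flat_le0 ?(ltW x0) //.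
  by rewrite mulr0 addr0.
- pose G := ((fun y : R => y^-1) ^+ k) * (fun y : R => expR (- y^-1)).
  have nE : \forall y \near x, G y = flat k y.
    have : nbhs x [set y | 0 < y] by apply: open_nbhs_nbhs; split => //; exact: open_gt.
    apply: filterS => y /= y0; rewrite /flat y0 /G /=.
    by congr (_ * _); rewrite fctE.
  have h1 : is_derive x 1 (fun y : R => y^-1) (- x ^- 2).
    apply: DeriveDef; first by apply: (@derivableV _ _ id); rewrite ?gt_eqF.
    by rewrite (@deriveV _ _ id) ?gt_eqF // derive_id /GRing.scale /= mulr1.
  have h2 := @is_deriveX _ _ _ k x 1 (- x ^- 2) h1.
  have h3 : is_derive x 1 (fun y : R => - y^-1) (x ^- 2).
    by apply: is_derive_eq (is_deriveN h1) _; rewrite opprK.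
  have h4 : is_derive x 1 (fun y : R => expR (- y^-1)) (expR (- x^-1) * x ^- 2).
    apply: DeriveDef.
      apply/derivable1_diffP; apply: (@differentiable_comp _ _ _ _ (fun y : R => - y^-1) expR).
        by apply/derivable1_diffP; case: h3.
      by apply/derivable1_diffP; exact: derivable_expR.
    rewrite -derive1E (@derive1_comp _ (fun y : R => - y^-1) expR); last 2 first.
    - by case: h3.
    - exact: derivable_expR.
    by rewrite !derive1E derive_val; case: h3 => _ ->.
  have h5 := is_deriveM h2 h4.
  split; first by apply: near_eq_derivable nE _; case: h5.
  rewrite derive1E -(near_eq_derive _ nE); case: h5 => _ ->.
  rewrite /flat x0 !fctE /GRing.scale /= -exprVn.
  case: k {G nE h2} => [|k]; first by rewrite !expr0 !expr1 !mul0r !mulr0 oppr0 mul0r add0r addr0 mul1r mulrC.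
  by rewrite !exprS /=; ring.
(* At 0 the quadratic bound leaves a difference quotient of size at most a constant times |h|. *)
- have lim0 : (fun h : R => h^-1 *: (flat k (h + 0) - flat k 0)) @ 0^' --> (0 : R).
    rewrite (flat_le0 _ (lexx 0)); under eq_fun do rewrite addr0 subr0.
    apply/norm_cvg0P; apply: (@squeeze_cvgr _ _ _ _ (cst 0) (fun h => k.+2%:R ^+ k.+2 * `|h|)).
    + near=> h.
      have h0 : h != 0 by near: h; exact: nbhs_dnbhs_neq.
      rewrite normr_ge0 /= /GRing.scale /= normrM normfV mulrC ler_pdivrMr ?normr_gt0 //.
      by rewrite -mulrA -expr2 real_normK ?num_real // ger0_norm ?flat_ge0 // flat_le.
    + exact: cvg_cst.
    + rewrite -[X in _ --> X](mulr0 (k.+2%:R ^+ k.+2 : R)); apply: cvgMr.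
      have c0 : `|h| @[h --> (0 : R)] --> (0 : R).
        by have := @norm_continuous _ R 0; rewrite /continuous_at normr0; exact.
      exact: (cvg_trans (cvg_app (fun h : R => `|h|) (@cvg_within _ (nbhs (0 : R)) _ _)) c0).
  split.
    apply/cvg_ex; exists 0.
    suff -> : (fun h : R => h^-1 *: ((flat k \o shift 0) (h *: (1 : R)) - flat k 0)) =
      (fun h : R => h^-1 *: (flat k (h + 0) - flat k 0)) by exact: lim0.
    by apply/funext => h /=; rewrite /shift /= [h%:A]mulr1.
  by rewrite !flat_le0 // mulr0 addr0; apply: cvg_lim lim0.
Unshelve. all: by end_near. Qed.

(** By [flat_derive] every derivative is a finite combination of members of the family; the list [r]
    records coefficients and exponents. *)
Lemma smooth_flat k : smooth_on [set: R] (rC (flat k)).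
Proof.
have h n : exists r : seq (R[i] * nat),
    derivC n (rC (flat k)) = fun x => \sum_(c <- r) c.1 * rC (flat c.2) x.
  elim: n => [|n [r IH]].
    exists [:: (1, k)]; rewrite derivC0; apply/funext => x.
    by rewrite big_seq1 mul1r.
  exists (flatten [seq [:: (c.1 * (- c.2%:R), c.2.+1); (c.1, c.2.+2)] | c <- r]).
  apply/funext => x; rewrite (derivCS n (rC (flat k))) IH.
  have dd (c : R[i] * nat) := cdableZ c.1 (cdable_rC (flat_derive c.2 x).1).
  rewrite (cdable_sum r dd).2 big_flatten big_map; apply: eq_bigr => c _.
  rewrite big_cons big_seq1 /= (derivC1Z _ (cdable_rC (flat_derive c.2 x).1)).
  rewrite derivC1_rC (flat_derive c.2 x).2 /rC rmorphD rmorphM rmorphN rmorph_nat /=.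
  by rewrite mulrDr mulrA.
apply/smooth_onE => n x _; have [r ->] := h n.
have dd (c : R[i] * nat) := cdableZ c.1 (cdable_rC (flat_derive c.2 x).1).
exact: (cdable_sum r dd).1.
Qed.

End FlatFunction.

Section Cutoffs.
Variable R : realType.
Implicit Types (f : R -> R[i]) (x c d : R).

Lemma smooth_onT_cdable f n x : smooth_on [set: R] f -> cdable (derivC n f) x.
Proof. by move=> /smooth_onE/(_ n x Logic.I). Qed.

Lemma cdable_affine f c d x : cdable f (c * x + d) ->
  cdable (fun y => f (c * y + d)) x /\
  derivC 1 (fun y => f (c * y + d)) x = c%:C * derivC 1 f (c * x + d).
Proof.
pose u (y : R) := c * y + d.
have hu : is_derive x 1 u c.
  have h := is_deriveD (is_deriveZ c (is_derive_id x (1 : R))) (is_derive_cst d x (1 : R)).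
  by apply: is_derive_eq; rewrite addr0 /GRing.scale /= mulr1.
have tr (g : R -> R) : derivable g (u x) 1 -> derivable (g \o u) x 1 /\
    derive1 (g \o u) x = derive1 g (u x) * c.
  move=> gx; split.
    apply/derivable1_diffP; apply: differentiable_comp.
      by apply/derivable1_diffP; case: hu.
    exact/derivable1_diffP.
  have du : derivable u x 1 by case: hu.
  by rewrite (derive1_comp du gx); congr (_ * _); rewrite derive1E; case: hu.
move=> [/tr[f1 f1'] /tr[f2 f2']]; split; first by split.
rewrite /derivC !derive1n1; apply: complex_ReIm => /=.
  by rewrite mul0r subr0 mulrC -f1'.
by rewrite mul0r addr0 mulrC -f2'.
Qed.

Lemma derivC_affine f c d n : smooth_on [set: R] f ->
  derivC n (fun y => f (c * y + d)) = fun x => c%:C ^+ n * derivC n f (c * x + d).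
Proof.
move=> sf; elim: n => [|n IH]; apply/funext => x.
  by rewrite !derivC0 expr0 mul1r.
have h := @cdable_affine (derivC n f) c d x (smooth_onT_cdable n (c * x + d) sf).
by rewrite (derivCS n (fun y => f (c * y + d))) IH (derivC1Z _ h.1) h.2 mulrA -exprSr.
Qed.

Lemma smooth_affine f c d : smooth_on [set: R] f ->
  smooth_on [set: R] (fun y => f (c * y + d)).
Proof.
move=> sf; apply/smooth_onE => n x _; rewrite derivC_affine //.
exact: (cdableZ _ (@cdable_affine (derivC n f) c d x (smooth_onT_cdable n (c * x + d) sf)).1).
Qed.

(** With q = 1 / h, each derivative of q has the form a q^m with [a] smooth: differentiating and
    writing q^m as h q^(m+1) gives the new numerator a' h - m a h'. *)
Lemma smooth_inv (h : R -> R) : (forall x, 0 < h x) ->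
  smooth_on [set: R] (rC h) -> smooth_on [set: R] (rC (fun x => (h x)^-1)).
Proof.
move=> h0 sh; pose q := rC (fun x => (h x)^-1).
have hq x : rC h x * q x = 1 by rewrite /q /rC -rmorphM /= mulfV // gt_eqF.
have [dh dh'] : (forall x, cdable (rC h) x) /\ (forall x, derivable h x 1).
  by split=> x; have := smooth_onT_cdable 0 x sh; rewrite derivC0 // => -[].
have dq x : cdable q x /\ derivC 1 q x = - derivC 1 (rC h) x * q x ^+ 2.
  have dv : derivable (fun y => (h y)^-1) x 1 by apply: derivableV; rewrite ?gt_eqF.
  split; first exact: cdable_rC.
  rewrite !derivC1_rC !derive1E deriveV ?gt_eqF // /q /rC -rmorphXn -rmorphN -rmorphM.
  by rewrite exprVn /GRing.scale /= mulNr mulrC mulNr.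
have dqm m x : cdable (fun y => q y ^+ m) x /\
    derivC 1 (fun y => q y ^+ m) x = - m%:R * derivC 1 (rC h) x * q x ^+ m.+1.
  elim: m => [|m [IH1 IH2]].
    under eq_fun do rewrite expr0.
    split; first exact: cdable_cst.
    by rewrite derivC1_cst oppr0 !mul0r.
  under eq_fun do rewrite exprS.
  split; first exact: (cdableM (dq x).1 IH1).
  rewrite (derivC1M (dq x).1 IH1) IH2 (dq x).2 -natr1 !exprS; ring.
have main n : exists (a : R -> R[i]) m, smooth_on [set: R] a /\
    derivC n q = fun x => a x * q x ^+ m.
  elim: n => [|n [a [m [sa E]]]].
    exists (fun=> 1), 1; split; first exact: smooth_on_cst.
    by rewrite derivC0; apply/funext => x; rewrite mul1r expr1.
  exists (fun x => derivC 1 a x * rC h x + (- m%:R) * (a x * derivC 1 (rC h) x)), m.+1; split.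
    have oT := @openT R.
    apply: (smooth_onD oT (smooth_onM oT (smooth_on_derivC 1 sa) sh)).
    exact: (smooth_onZ _ oT (smooth_onM oT sa (smooth_on_derivC 1 sh))).
  apply/funext => x; rewrite (derivCS n q) E.
  have ax : cdable a x by have := smooth_onT_cdable 0 x sa; rewrite derivC0.
  rewrite (derivC1M ax (dqm m x).1) (dqm m x).2 mulrDl exprS.
  have -> : derivC 1 a x * rC h x * (q x * q x ^+ m) = derivC 1 a x * q x ^+ m * (rC h x * q x).
    ring.
  rewrite hq mulr1; congr (_ + _); ring.
apply/smooth_onE => n x _; have [a [m [sa ->]]] := main n.
have ax : cdable a x by have := smooth_onT_cdable 0 x sa; rewrite derivC0.
exact: (cdableM ax (dqm m x).1).
Qed.

Lemma rCM (g h : R -> R) : rC (fun x => g x * h x) = fun x => rC g x * rC h x.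
Proof. by apply/funext => x; rewrite /rC rmorphM. Qed.

Lemma rCD (g h : R -> R) : rC (fun x => g x + h x) = fun x => rC g x + rC h x.
Proof. by apply/funext => x; rewrite /rC rmorphD. Qed.

Lemma smooth_flat_right a : smooth_on [set: R] (rC (fun x => flat 0 (x - a))).
Proof.
have := smooth_affine 1 (- a) (@smooth_flat R 0).
by under eq_fun do rewrite mul1r.
Qed.

Lemma smooth_flat_left b : smooth_on [set: R] (rC (fun x => flat 0 (b - x))).
Proof.
have := smooth_affine (-1) b (@smooth_flat R 0).
by under eq_fun do rewrite mulN1r addrC.
Qed.

Lemma bump_ex (a b : R) : a < b -> exists g : R -> R,
  [/\ smooth_on [set: R] (rC g), forall x, 0 <= g x,
      (forall x, a < x < b -> 0 < g x) & forall x, g x != 0 -> a < x < b].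
Proof.
move=> ab; exists (fun x => flat 0 (x - a) * flat 0 (b - x)); split.
- by rewrite rCM; exact: (smooth_onM openT (smooth_flat_right a) (smooth_flat_left b)).
- by move=> x; rewrite mulr_ge0 ?flat_ge0.
- by move=> x /andP[ax xb]; rewrite mulr_gt0 ?flat_gt0 ?subr_gt0.
- move=> x; apply: contra_neqT; rewrite negb_and -!leNgt => /orP[xa|bx].
    by rewrite flat_le0 ?mul0r // subr_le0.
  by rewrite [X in _ * X]flat_le0 ?mulr0 // subr_le0.
Qed.

(** The quotient flat(b - x) / (flat(x - a) + flat(b - x)); its denominator never vanishes because
    [a < b]. *)
Lemma step_ex (a b : R) : a < b -> exists g : R -> R,
  [/\ smooth_on [set: R] (rC g), (forall x, x <= a -> g x = 1) &
      forall x, b <= x -> g x = 0].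
Proof.
move=> ab; pose h x := flat 0 (x - a) + flat 0 (b - x).
have h0 x : 0 < h x.
  rewrite /h; have [xa|ax] := leP x a.
    by rewrite ltr_wpDl ?flat_ge0 // flat_gt0 // subr_gt0 (le_lt_trans xa).
  by rewrite ltr_pwDl ?flat_ge0 // flat_gt0 // subr_gt0.
exists (fun x => flat 0 (b - x) * (h x)^-1); split.
- rewrite rCM; apply: (smooth_onM openT (smooth_flat_left b)); apply: smooth_inv => //.
  by rewrite rCD; exact: (smooth_onD openT (smooth_flat_right a) (smooth_flat_left b)).
- move=> x xa; rewrite /h (@flat_le0 _ _ (x - a)) ?subr_le0 // add0r mulfV //.
  by rewrite gt_eqF // flat_gt0 // subr_gt0 (le_lt_trans xa).
- by move=> x bx; rewrite flat_le0 ?mul0r // subr_le0.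
Qed.

Definition monom k (x : R) : R := x ^+ k / k`!%:R.

Lemma monom_derive k x : cdable (rC (monom k)) x /\
  derivC 1 (rC (monom k)) x = if k is k'.+1 then rC (monom k') x else 0.
Proof.
have h := is_deriveZ (k`!%:R^-1) (is_deriveX k (is_derive_id x (1 : R))).
have E : monom k = (k`!%:R^-1 \*: (id ^+ k)).
  by apply/funext => y; rewrite /monom /= fctE mulrC.
split; first by apply: cdable_rC; rewrite E; case: h.
rewrite derivC1_rC derive1E E; case: h => _ ->.
case: k {E} => [|k]; first by rewrite mul0r scale0r scaler0.
congr (_%:C); rewrite /monom /GRing.scale /= mulr1 factS natrM invfM.
have k0 : k.+1%:R != 0 :> R by rewrite pnatr_eq0.
by rewrite mulrACA mulVf // mul1r mulrC.
Qed.

Lemma derivC_monom n k :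
  derivC n (rC (monom k)) = if (n <= k)%N then rC (monom (k - n)) else fun=> 0.
Proof.
elim: n => [|n IH]; first by rewrite derivC0 subn0.
apply/funext => x; rewrite (derivCS n (rC (monom k))) IH.
have [nk|kn] := ltnP n k; last first.
  have [kn'|] := leqP n k; last by rewrite derivC1_cst.
  have -> : (k - n = 0)%N by apply/eqP; rewrite subn_eq0.
  exact: (monom_derive 0 x).2.
by rewrite (ltnW nk) (monom_derive (k - n) x).2 -(subnSK nk).
Qed.

Lemma smooth_monom k : smooth_on [set: R] (rC (monom k)).
Proof.
apply/smooth_onE => n x _; rewrite derivC_monom; case: ifP => _.
  exact: (monom_derive _ x).1.
exact: cdable_cst.
Qed.

(** Near 0, [T] is x^k / k!, whose only nonzero derivative at 0 is the k-th, equal to 1. The cutoff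
    g(x) g(-x) is 1 on [-1/2, 1/2] and 0 outside [-1, 1]. *)
Lemma dual_monomial_ex k : exists T : R -> R[i],
  [/\ smooth_on [set: R] T, (forall x, T x != 0 -> -1 <= x <= 1) &
      forall j, derivC j T 0 = (j == k)%:R].
Proof.
have [g [sg g1 g0]] := @step_ex (1 / 2) 1 ltac:(lra).
have sg' := smooth_affine (-1) 0 sg.
exists (fun x => rC (monom k) x * (rC g x * rC g (-1 * x + 0))); split.
- exact: (smooth_onM openT (@smooth_monom k) (smooth_onM openT sg sg')).
- move=> x; apply: contra_neqT; rewrite negb_and -!ltNge => /orP[x1|x1].
    by rewrite [X in _ * (_ * X)]/rC g0 ?mulr0 //; lra.
  by rewrite [X in _ * (X * _)]/rC g0 ?mul0r ?mulr0 //; lra.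
- move=> j; rewrite (@near_eq_derivC_at _ j _ (rC (monom k)) 0).
    rewrite derivC_monom; have [jk|kj] := leqP j k.
      rewrite /rC /monom expr0n subn_eq0 eqn_leq jk /=.
      have [kj|kj] := leqP k j; last by rewrite mul0r.
      have -> : (k - j = 0)%N by apply/eqP; rewrite subn_eq0.
      by rewrite fact0 divr1.
    by rewrite eqn_leq leqNgt kj.
  have : nbhs (0 : R) `](-1/2), (1/2)[.
    by apply: near_in_itvoo; rewrite in_itv /=; apply/andP; split; lra.
  apply: filterS => y /=; rewrite in_itv /= => /andP[y1 y2].
  by rewrite /rC !g1 ?mulr1 //; lra.
Qed.

End Cutoffs.

Section TestFunctionTools.
Variable R : realType.
Implicit Types (t u : testfun R) (f : R -> R[i]) (U V : set R) (x : R).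

Lemma supp_sub f (A : set R) : closed A -> (forall x, f x != 0 -> A x) -> supp f `<=` A.
Proof. by move=> cA fA; rewrite (closure_id A).1 //; apply: closureS => x; exact: fA. Qed.

Lemma supp_out f x : ~ supp f x -> f x = 0.
Proof. by apply: contra_notP => /eqP fx; apply: subset_closure. Qed.

Lemma testfun_smooth t : smooth_on [set: R] t.
Proof. by have := set_mem (testfunP t); case. Qed.

Lemma testfun_cdable t n x : cdable (derivC n t) x.
Proof. exact: (smooth_onT_cdable n x (testfun_smooth t)). Qed.

Lemma testfun_compact t : compact (supp t).
Proof. by have := set_mem (testfunP t); case. Qed.

Lemma testfun_ext t u : (forall x, t x = u x) -> t = u.
Proof. by move=> tu; apply: val_inj; apply/funext. Qed.

Lemma testfun_itv t : exists a b : R, a < b /\ supp t `<=` `[a, b].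
Proof.
have /compact_bounded[M [Mr]] := @testfun_compact t.
move=> /(_ (`|M| + 1)); rewrite (le_lt_trans (ler_norm M)) ?ltrDl // => /(_ isT) h.
exists (- (`|M| + 1)), (`|M| + 1); split.
  by have := normr_ge0 M; lra.
move=> x /h /=; rewrite ler_norml => /andP[x1 x2].
by rewrite in_itv /= x1 x2.
Qed.

Lemma testfun_ex f (a b : R) : smooth_on [set: R] f ->
  (forall x, f x != 0 -> a <= x <= b) -> exists t, (t : R -> R[i]) = f.
Proof.
move=> sf fab.
have tf : test_function f.
  split => //; apply: (subclosed_compact (@closed_closure _ _) (@segment_compact _ a b)).
  by apply: supp_sub; [exact: interval_closed|move=> x /fab /=; rewrite in_itv].
by exists (Testfun (mem_set tf)).
Qed.

Lemma nbhs_nsupp f x : ~ supp f x -> \forall y \near x, f y = 0.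
Proof.
move=> xf; have : open (~` supp f) by rewrite openC; exact: closed_closure.
by rewrite openE => /(_ x xf); apply: filterS => y; exact: supp_out.
Qed.

Lemma derivC_out n f x : ~ supp f x -> derivC n f x = 0.
Proof.
move=> xf; rewrite (near_eq_derivC_at n (nbhs_nsupp xf)).
by rewrite /derivC /reC /imC /= !derive1n0f.
Qed.

End TestFunctionTools.

(** * Localization: products with local smooth functions, and gluing *)

Section Gluing.
Variable R : realType.
Implicit Types (t u v s : testfun R) (f : R -> R[i]) (U V : set R) (x : R).

Lemma testfunDE u v x : (u + v) x = u x + v x.
Proof. by []. Qed.

Lemma testfunZE (c : R[i]) u x : (c *: u) x = c * u x.
Proof. by []. Qed.

(** Points of [supp t] have [f] smooth around them, and off [supp t] the product is locally 0
    whatever [f] is. *)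
Lemma tmul_ex U f t : open U -> smooth_on U f -> supp t `<=` U ->
  exists s, forall x, s x = f x * t x.
Proof.
move=> oU fU tU; have [a [b [_ tab]]] := testfun_itv t.
have st : smooth_on U t by apply: smooth_on_sub (testfun_smooth t).
have sft : smooth_on [set: R] (fun x => f x * t x).
  apply/smooth_onE => n x _; have [tx|tx] := pselect (supp t x).
    exact: (smooth_onE _ _).1 (smooth_onM oU fU st) n x (tU x tx).
  have nE : \forall y \near x, (fun=> 0) y = f y * t y.
    by apply: filterS (nbhs_nsupp tx) => y ->; rewrite mulr0.
  apply: (near_eq_cdable (near_eq_derivC n nE)).
  exact: (smooth_onE _ _).1 (@smooth_on_cst _ [set: R] 0) n x Logic.I.
have [x|s sE] := @testfun_ex _ _ a b sft.
  apply: contra_neqT => xab; rewrite (@supp_out _ t x) ?mulr0 // => /tab /=.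
  by rewrite in_itv /= (negbTE xab).
by exists s => x; rewrite sE.
Qed.

Lemma supp_mul (s : R -> R[i]) f t : (forall x, s x = f x * t x) -> supp s `<=` supp t.
Proof.
move=> sE; apply: supp_sub; first exact: closed_closure.
move=> x; rewrite sE => xn; apply: subset_closure => /=.
by apply: contra_neq xn => ->; rewrite mulr0.
Qed.

Lemma supp_itv t (a b : R) : (forall x, t x != 0 -> a <= x <= b) -> supp t `<=` `[a, b].
Proof.
by move=> h; apply: supp_sub; [exact: interval_closed|move=> x /h /=; rewrite in_itv].
Qed.

Lemma open_nbhs_itv U x : open_nbhs x U ->
  exists2 e : R, 0 < e & forall y, x - e < y < x + e -> U y.
Proof.
move=> /open_nbhs_nbhs /nbhs_ballP[e /= e0 eU]; exists e => // y xy.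
apply: eU; rewrite /ball /= distrC; move: xy => /andP[y1 y2].
by rewrite ltr_norml; apply/andP; split; lra.
Qed.

(* Real induction on the right endpoint of the support: a smooth step near the
   supremum cuts off a piece on which L vanishes locally. *)
Lemma gluing (L : testfun R -> R[i]^o) : linear L ->
  (forall x, exists2 U, open_nbhs x U & forall t, supp t `<=` U -> L t = 0) ->
  forall t, L t = 0.
Proof.
move=> linL Lloc t; have [a [b [ab tab]]] := testfun_itv t.
pose S := [set c | a <= c /\ forall u, supp u `<=` `[a, c] -> L u = 0].
have Sa : S a.
  split => // u ua; have [U [oU Ua] UL] := Lloc a; apply: UL => x /ua /=.
  by rewrite in_itv /= -eq_le => /eqP <-.
have [[c [ac Sc] bc]|nSb] := pselect (exists2 c, S c & b <= c).
  apply: Sc => x /tab /=; rewrite !in_itv /= => /andP[-> xb] /=.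
  exact: le_trans bc.
have Sub : has_ubound S.
  exists b => c Sc; rewrite leNgt; apply/negP => bc; apply: nSb.
  by exists c => //; exact: ltW.
have hS : has_sup S by split => //; exists a.
have [U oU UL] := Lloc (sup S).
have [e e0 eU] := open_nbhs_itv oU.
have [c1 Sc1 c1e] := sup_adherent (eps := e / 2) ltac:(lra) hS.
have aS : a <= sup S by exact: ub_le_sup.
suff : S (sup S + e / 2).
  by move=> /(ub_le_sup Sub) h; exfalso; lra.
split; first lra.
move=> u uS.
(* The step falls between sup S - 3e/4 and sup S - e/2. Thus g u is supported left of [c1], which
   exceeds sup S - e/2, and u - g u is supported in [U]. *)
have [g [sg g1 g0]] := @step_ex R (sup S - 3 / 4 * e) (sup S - e / 2) ltac:(lra).
have oT := @openT R.
have [v1 v1E] := tmul_ex oT sg (fun x (_ : supp u x) => Logic.I).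
have sg' := smooth_onD oT (smooth_onZ (-1) oT sg) (@smooth_on_cst R [set: R] 1).
have [v2 v2E] := tmul_ex oT sg' (fun x (_ : supp u x) => Logic.I).
have -> : u = 1 *: v1 + v2.
  apply: testfun_ext => x; rewrite testfunDE testfunZE v1E v2E; ring.
rewrite linL.
have uab x : u x != 0 -> a <= x <= sup S + e / 2.
  by move=> ux; have /uS /= : supp u x by exact: subset_closure; rewrite in_itv.
have -> : L v1 = 0.
  apply: Sc1.2; apply: supp_itv => x; rewrite v1E mulf_eq0 negb_or => /andP[gx ux].
  have /andP[-> _] /= := uab x ux.
  rewrite leNgt; apply: contra gx => gx; rewrite /rC g0 //; lra.
rewrite scaler0 add0r; apply: UL.
apply: (@subset_trans _ `[sup S - 3 / 4 * e, sup S + e / 2]).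
  apply: supp_itv => x; rewrite v2E mulf_eq0 negb_or => /andP[gx ux].
  have /andP[_ ->] := uab x ux; rewrite andbT.
  rewrite leNgt; apply: contra gx => gx; rewrite /rC g1 ?(ltW gx) //.
  by rewrite mulN1r addNr.
by move=> x /=; rewrite in_itv /= => /andP[x1 x2]; apply: eU; apply/andP; split; lra.
Qed.

End Gluing.

(** * Integration *)

Section Integrals.
Variable R : realType.
Notation mu := (@lebesgue_measure R).
Implicit Types (h u : R -> R) (f g : R -> R[i]) (t : testfun R).

Lemma integrable_supported h (a b B : R) : measurable_fun setT h ->
  (forall x, `|h x| <= B) -> (forall x, h x != 0 -> a <= x <= b) ->
  mu.-integrable setT (EFin \o h).
Proof.
move=> mh hB hab.
have -> : h = h \_ `[a, b].
  apply/funext => x; rewrite patchE; case: ifPn => // xab.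
  apply/eqP; apply: contraNT xab => /hab xab; rewrite inE /= in_itv //.
rewrite -restrict_EFin; apply/(integrable_restrict _ _) => //.
rewrite setTI; apply: (@measurable_bounded_integrable _ _ _ mu) => //.
- by rewrite /= lebesgue_measure_itv /=; case: ifP => _; rewrite ?ltry.
- exact: measurable_funTS.
- exists B; split; first exact: num_real.
  by move=> M BM x _; exact: le_trans (ltW BM).
Qed.

Lemma le_integral_supported h (a b B : R) : a <= b -> 0 <= B ->
  (forall x, `|h x| <= B) -> (forall x, h x != 0 -> a <= x <= b) ->
  measurable_fun setT h -> `|\int[mu]_(x in setT) h x| <= B * (b - a).
Proof.
move=> ab B0 hB hab mh.
have hi := integrable_supported mh hB hab.
have hi' : mu.-integrable setT (EFin \o (fun x => `|h x|)).
  by apply: (@integrable_supported _ a b B); [exact: measurableT_comp|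
    move=> x; rewrite normr_id|move=> x; rewrite normr_eq0; exact: hab].
apply: (le_trans (le_normr_Rintegral measurableT hi)).
pose k := (cst B \_ `[a, b] : R -> R).
have mk : measurable_fun setT k by apply/(measurable_restrictT _ _).1.
have kE x : k x = if a <= x <= b then B else 0.
  by rewrite /k patchE mem_setE in_itv.
have ki : mu.-integrable setT (EFin \o k).
  apply: (@integrable_supported _ a b B) => //.
    by move=> x; rewrite kE; case: ifP => _; rewrite ?normr0 // ger0_norm.
  move=> x; rewrite kE; case: ifPn => [|_]; last by rewrite eqxx.
  by [].
apply: (le_trans (le_Rintegral measurableT hi' ki _)).
  move=> x _; rewrite kE; case: ifPn => // xab.
  suff -> : h x = 0 by rewrite normr0.
  by apply/eqP; apply: contraNT xab => /hab.
rewrite /k -Rintegral_mkcond Rintegral_cst //.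
rewrite /= lebesgue_measure_itv /= lte_fin; case: ifPn => [_|_] /=; first by rewrite lexx.
by rewrite mulr0 mulr_ge0 // subr_ge0.
Qed.

Lemma Rdominated_cvg (u_ : nat -> R -> R) u h (s : seq R) :
  (forall n, measurable_fun setT (u_ n)) -> measurable_fun setT u ->
  (forall x, x \notin s -> u_ ^~ x @ \oo --> u x) ->
  mu.-integrable setT (EFin \o h) -> (forall x n, `|u_ n x| <= h x) ->
  (\int[mu]_(x in setT) u_ n x) @[n --> \oo] --> \int[mu]_(x in setT) u x.
Proof.
move=> mu_ mu' uu hi uh.
have cs : countable [set` s] by apply: finite_set_countable; exact: finite_seq.
have f_f : {ae mu, forall x, setT x -> (fun n => (u_ n x)%:E) @ \oo --> (u x)%:E}.
  exists [set` s]; split.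
  - by apply: countable_measurable => //; exact: measurable_set1.
  - exact: countable_lebesgue_measure0.
  - move=> x /=; apply: contra_notP => /negP xs _.
    by apply: cvg_EFin; [exact: nearW|exact: uu].
have f_g : {ae mu, forall x n, setT x -> (`|(u_ n x)%:E| <= (EFin \o h) x)%E}.
  by apply: aeW => x n _; rewrite lee_fin; exact: uh.
have mEF (g : R -> R) : measurable_fun setT g -> measurable_fun setT (EFin \o g).
  by move=> mg; apply/measurable_EFinP.
have [ui _ lim] := @dominated_convergence _ _ R mu setT measurableT
  (fun n x => (u_ n x)%:E) (EFin \o u) (EFin \o h)
  (fun n => mEF _ (mu_ n)) (mEF _ mu')
  f_f hi f_g.
apply: fine_cvg; rewrite fineK; last exact: integrable_fin_num.
exact: lim.
Qed.


(** The image of Lebesgue measure under a translation gives half-open intervals their length, hence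
    is Lebesgue measure. *)
Lemma Rintegral_translate h (e : R) : measurable_fun setT h ->
  mu.-integrable setT (EFin \o (fun x => h (x + e))) ->
  \int[mu]_(x in setT) h (x + e) = \int[mu]_(x in setT) h x.
Proof.
move=> mh hi; pose phi (x : R) := x + e.
have mphi : measurable_fun setT (phi : measurableTypeR R -> measurableTypeR R).
  by apply: measurable_funD => //; exact: measurable_cst.
have mEh : measurable_fun [set: measurableTypeR R] (EFin \o h) by apply/measurable_EFinP.
rewrite /Rintegral; congr fine.
have := integral_pushforward mphi (mu := mu) (D := setT) mEh hi measurableT.
rewrite preimage_setT => <-.
apply: eq_measure_integral => A mA _; apply/esym.
apply: (lebesgue_measure_unique (mu := measure_function_pushforward__canonical__measure_function_Measure mu mphi)) mA.
move=> X; rewrite /ocitv /= => -[[a b] /= _ <-].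
rewrite /pushforward (_ : phi @^-1` _ = `]a - e, b - e]%classic).
  rewrite !lebesgue_measure_itv /= !lte_fin ltrD2r; case: ifP => // _.
  by rewrite -!EFinB; congr EFin; ring.
by apply/seteqP; split => x; rewrite /phi /= !in_itv /= ltrBlDr lerBrDr.
Qed.

End Integrals.

Section ComplexIntegrals.
Variable R : realType.
Notation mu := (@lebesgue_measure R).
Notation normc := Normc.normc.
Implicit Types (f g : R -> R[i]) (t : testfun R).

Lemma normc_ge0 (z : R[i]) : 0 <= normc z.
Proof. by case: z => a b; exact: sqrtr_ge0. Qed.

Lemma Re_le_normc (z : R[i]) : `|complex.Re z| <= normc z.
Proof.
by case: z => a b /=; rewrite -sqrtr_sqr ler_sqrt ?addr_ge0 ?sqr_ge0 // lerDl sqr_ge0.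
Qed.

Lemma Im_le_normc (z : R[i]) : `|complex.Im z| <= normc z.
Proof.
by case: z => a b /=; rewrite -sqrtr_sqr ler_sqrt ?addr_ge0 ?sqr_ge0 // lerDr sqr_ge0.
Qed.

Lemma normc_le_ReIm (z : R[i]) : normc z <= `|complex.Re z| + `|complex.Im z|.
Proof.
case: z => a b /=; rewrite -[leRHS]ger0_norm ?addr_ge0 // -sqrtr_sqr.
rewrite ler_sqrt ?sqr_ge0 // sqrrD !real_normK ?num_real //.
by rewrite addrAC lerDl mulrn_wge0 // mulr_ge0.
Qed.

Lemma normcD (y z : R[i]) : normc (y + z) <= normc y + normc z.
Proof.
have := lec_normD y z; rewrite -rmorphD /=.
by case/andP.
Qed.

Lemma normc_sum I (r : seq I) (F : I -> R[i]) :
  normc (\sum_(i <- r) F i) <= \sum_(i <- r) normc (F i).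
Proof.
elim: r => [|i r IH]; first by rewrite !big_nil Normc.normc0.
by rewrite !big_cons (le_trans (normcD _ _)) // lerD2l.
Qed.

Definition cintegrable f := mu.-integrable setT (EFin \o reC f) /\
  mu.-integrable setT (EFin \o imC f).

Definition cmeasurable f := measurable_fun setT (reC f) /\ measurable_fun setT (imC f).

Lemma cmeasurableM f g : cmeasurable f -> cmeasurable g -> cmeasurable (fun x => f x * g x).
Proof.
move=> [f1 f2] [g1 g2]; split.
  have -> : reC (fun x => f x * g x) = (fun x => reC f x * reC g x - imC f x * imC g x).
    by apply/funext => x; rewrite /reC cReM.
  by apply: measurable_funB; exact: measurable_funM.
have -> : imC (fun x => f x * g x) = (fun x => reC f x * imC g x + imC f x * reC g x).
  by apply/funext => x; rewrite /imC cImM.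
by apply: measurable_funD; exact: measurable_funM.
Qed.

Lemma integralCD f g : cintegrable f -> cintegrable g ->
  integralC (fun x => f x + g x) = integralC f + integralC g.
Proof.
move=> [f1 f2] [g1 g2]; apply: complex_ReIm; rewrite ?cReD ?cImD /integralC /=.
  have -> : reC (fun x => f x + g x) = (fun x => reC f x + reC g x).
    by apply/funext => x; rewrite /reC cReD.
  exact: RintegralD.
have -> : imC (fun x => f x + g x) = (fun x => imC f x + imC g x).
  by apply/funext => x; rewrite /imC cImD.
exact: RintegralD.
Qed.

Lemma integrableZ (c : R) (h : R -> R) : mu.-integrable setT (EFin \o h) ->
  mu.-integrable setT (EFin \o (fun x => c * h x)).
Proof.
move=> hi; have := integrableZl measurableT c hi.
by apply: eq_integrable => // x _; rewrite /= EFinM.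
Qed.

Lemma integralCZ (c : R[i]) f : cintegrable f ->
  integralC (fun x => c * f x) = c * integralC f.
Proof.
move=> [f1 f2]; apply: complex_ReIm; rewrite ?cReM ?cImM /integralC /=.
  have -> : reC (fun x => c * f x) =
      (fun x => complex.Re c * reC f x - complex.Im c * imC f x).
    by apply/funext => x; rewrite /reC cReM.
  rewrite RintegralB //; try exact: integrableZ.
  by rewrite !RintegralZl.
have -> : imC (fun x => c * f x) =
    (fun x => complex.Re c * imC f x + complex.Im c * reC f x).
  by apply/funext => x; rewrite /imC cImM.
rewrite RintegralD //; try exact: integrableZ.
by rewrite !RintegralZl.
Qed.

Lemma eq_integralC f g : (forall x, f x = g x) -> integralC f = integralC g.
Proof. by move=> /funext ->. Qed.

Lemma cintegrable_supported f (a b B : R) : cmeasurable f ->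
  (forall x, normc (f x) <= B) -> (forall x, f x != 0 -> a <= x <= b) ->
  cintegrable f.
Proof.
move=> [f1 f2] fB fab; split; apply: (@integrable_supported _ _ a b B) => //.
- by move=> x; exact: le_trans (Re_le_normc _) (fB x).
- by move=> x fx; apply: fab; apply: contra_neq fx; rewrite /reC => ->.
- by move=> x; exact: le_trans (Im_le_normc _) (fB x).
- by move=> x fx; apply: fab; apply: contra_neq fx; rewrite /imC => ->.
Qed.

Lemma normc_integralC_le f (a b B : R) : a <= b -> 0 <= B -> cmeasurable f ->
  (forall x, normc (f x) <= B) -> (forall x, f x != 0 -> a <= x <= b) ->
  normc (integralC f) <= 2 * (b - a) * B.
Proof.
move=> ab B0 [f1 f2] fB fab; apply: (le_trans (normc_le_ReIm _)).
have -> : 2 * (b - a) * B = B * (b - a) + B * (b - a) by ring.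
apply: lerD; apply: le_integral_supported => //.
- by move=> x; exact: le_trans (Re_le_normc _) (fB x).
- by move=> x fx; apply: fab; apply: contra_neq fx; rewrite /reC => ->.
- by move=> x; exact: le_trans (Im_le_normc _) (fB x).
- by move=> x fx; apply: fab; apply: contra_neq fx; rewrite /imC => ->.
Qed.

(** Unlike local integrability, this is stable under products; it contains the piecewise smooth
    functions and the derivatives of test functions. *)
Definition locally_bounded f := [/\ measurable_fun setT (reC f), measurable_fun setT (imC f)
  & forall a b : R, exists2 B, 0 <= B & forall x, a <= x <= b -> normc (f x) <= B].

Lemma integralC_dominated_cvg (F : nat -> R -> R[i]) f (a b B : R) (s : seq R) :
  (forall n, cmeasurable (F n)) -> cmeasurable f ->
  (forall x, x \notin s -> ccvg \oo (F ^~ x) (f x)) ->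
  (forall n x, normc (F n x) <= B) -> (forall n x, F n x != 0 -> a <= x <= b) ->
  ccvg \oo (fun n => integralC (F n)) (integralC f).
Proof.
move=> mF mf Ff FB Fab.
have B0 : 0 <= B := le_trans (normc_ge0 _) (FB 0%N 0).
pose k := (cst B \_ `[a, b] : R -> R).
have kE x : k x = if a <= x <= b then B else 0 by rewrite /k patchE mem_setE in_itv.
have ki : mu.-integrable setT (EFin \o k).
  apply: (@integrable_supported _ _ a b B) => //.
  - by apply/(measurable_restrictT _ _).1.
  - by move=> x; rewrite kE; case: ifP => _; rewrite ?normr0 // ger0_norm.
  - move=> x; rewrite kE; case: ifPn => [|_]; last by rewrite eqxx.
    by [].
have Fk x n : normc (F n x) <= k x.
  rewrite kE; case: ifPn => // xab; suff -> : F n x = 0 by rewrite Normc.normc0.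
  by apply/eqP; apply: contraNT xab => /Fab.
split.
  apply: (@Rdominated_cvg _ (fun n => reC (F n)) (reC f) k s) => //.
  - by move=> n; case: (mF n).
  - by case: mf.
  - by move=> x /Ff[].
  - by move=> x n; exact: le_trans (Re_le_normc _) (Fk x n).
apply: (@Rdominated_cvg _ (fun n => imC (F n)) (imC f) k s) => //.
- by move=> n; case: (mF n).
- by case: mf.
- by move=> x /Ff[].
- by move=> x n; exact: le_trans (Im_le_normc _) (Fk x n).
Qed.

Lemma cvgC_right_seq (u : R -> R[i]) l (d : R) : 0 < d ->
  (forall v : nat -> R, (forall n, 0 < v n < d) -> v n @[n --> \oo] --> 0 ->
     ccvg \oo (u \o v) l) -> cvgC u 0^'+ l.
Proof.
move=> d0 h.
have key (v : nat -> R) : (forall n, 0 < v n) -> v n @[n --> \oo] --> 0 ->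
    ccvg \oo (u \o v) l.
  move=> v0 v_0; have /cvgrPdist_lt/(_ _ d0)[N _ vN] := v_0.
  have [] := h (fun n => v (n + N)%N).
  - move=> n; rewrite v0 /=; have := vN (n + N)%N (leq_addl _ _).
    by rewrite /= sub0r normrN => /ltr_normlW.
  - by rewrite (cvg_shiftn N v).
  move=> h1 h2; split.
    by rewrite -(cvg_shiftn N (fun n => complex.Re ((u \o v) n))).
  by rewrite -(cvg_shiftn N (fun n => complex.Im ((u \o v) n))).
by split; apply/cvg_at_rightP => v [v0 v_0]; have [] := key v v0 v_0.
Qed.

Lemma locally_boundedM f g : locally_bounded f -> locally_bounded g ->
  locally_bounded (fun x => f x * g x).
Proof.
move=> [f1 f2 f3] [g1 g2 g3].
have [m1 m2] := @cmeasurableM f g (conj f1 f2) (conj g1 g2).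
split => // a b; have [B B0 fB] := f3 a b; have [C C0 gC] := g3 a b.
exists (B * C); first exact: mulr_ge0.
by move=> x xab; rewrite Normc.normcM ler_pM ?normc_ge0 ?fB ?gC.
Qed.

Lemma locally_bounded_cmeasurable f : locally_bounded f -> cmeasurable f.
Proof. by case. Qed.

Lemma locally_bounded_supported f (a b : R) : locally_bounded f ->
  (forall x, f x != 0 -> a <= x <= b) ->
  exists2 B, 0 <= B & forall x, normc (f x) <= B.
Proof.
move=> [_ _ /(_ a b)[B B0 fB]] fab; exists B => // x.
have [->|/fab /fB //] := eqVneq (f x) 0; by rewrite Normc.normc0.
Qed.

Lemma locally_bounded_cintegrable f (a b : R) : locally_bounded f ->
  (forall x, f x != 0 -> a <= x <= b) -> cintegrable f.
Proof.
move=> lf fab; have [B B0 fB] := locally_bounded_supported lf fab.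
exact: cintegrable_supported (locally_bounded_cmeasurable lf) fB fab.
Qed.

Lemma testfun_off t (a b : R) : supp t `<=` `[a, b] -> forall x, t x != 0 -> a <= x <= b.
Proof.
by move=> tab x tx; have /tab /= : supp t x by [exact: subset_closure]; rewrite in_itv.
Qed.

Lemma integralC_translate f (e : R) : cmeasurable f ->
  cintegrable (fun x => f (x + e)) -> integralC (fun x => f (x + e)) = integralC f.
Proof.
move=> [m1 m2] [i1 i2]; rewrite /integralC; congr (_ +i* _).
  exact: (Rintegral_translate m1 i1).
exact: (Rintegral_translate m2 i2).
Qed.

End ComplexIntegrals.

(** * Piecewise smooth functions *)

Section PiecewiseSmooth.
Variable R : realType.
Notation normc := Normc.normc.
Implicit Types (f g : R -> R[i]) (t : testfun R) (s : seq R) (x : R).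

Lemma near_punctured s x : exists2 e : R, 0 < e &
  forall y, y != x -> x - e < y < x + e -> y \notin s.
Proof.
elim: s => [|z s [e e0 IH]]; first by exists 1.
have [zx|zx] := eqVneq z x.
  exists e => // y yx ye; rewrite in_cons negb_or IH // andbT zx //.
exists (Num.min e `|z - x|); first by rewrite lt_min e0 normr_gt0 subr_eq0.
move=> y yx /andP[y1 y2]; have m1 : Num.min e `|z - x| <= e by rewrite ge_min lexx.
have m2 : Num.min e `|z - x| <= `|z - x| by rewrite ge_min lexx orbT.
rewrite in_cons negb_or IH //; last by apply/andP; split; lra.
rewrite andbT; apply/eqP => yz; subst y.
have : `|z - x| < Num.min e `|z - x| by rewrite ltr_norml; apply/andP; split; lra.
lra.
Qed.

Lemma near_left_notin s x : \forall y \near x^'-, y \notin s.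
Proof.
have [e e0 he] := near_punctured s x.
near=> y; apply: he.
  by rewrite lt_eqF //; near: y; exact: nbhs_left_lt.
apply/andP; split; first by near: y; apply: nbhs_left_gt; rewrite ltrBlDr ltrDl.
by rewrite (@lt_trans _ _ x) ?ltrDl //; near: y; exact: nbhs_left_lt.
Unshelve. all: by end_near. Qed.

Lemma near_right_notin s x : \forall y \near x^'+, y \notin s.
Proof.
have [e e0 he] := near_punctured s x.
near=> y; apply: he.
  by rewrite gt_eqF //; near: y; exact: nbhs_right_gt.
apply/andP; split; last by near: y; apply: nbhs_right_lt; rewrite ltrDl.
by rewrite (@lt_trans _ _ x) ?ltrBlDr ?ltrDl //; near: y; exact: nbhs_right_gt.
Unshelve. all: by end_near. Qed.

Lemma open_notin s : open [set x : R | x \notin s].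
Proof.
rewrite openE => x /= xs; have [e e0 he] := near_punctured s x.
apply/nbhs_ballP; exists e => // y; rewrite /ball /= distrC => xy.
have [->//|yx] := eqVneq y x; apply: he => //.
by move: xy; rewrite ltr_norml => /andP[? ?]; apply/andP; split; lra.
Qed.

(** One-sided limits are asked at every point rather than only on [s], so that [s] may be enlarged
    and all functions of the proof can share one list. *)
Definition pws s f : Prop := smooth_on [set x | x \notin s] f /\
  forall n x, (exists l, cvgC (derivC n f) x^'- l) /\ (exists l, cvgC (derivC n f) x^'+ l).

Definition lval f x : R[i] := xget 0 [set l | cvgC f x^'- l].
Definition rval f x : R[i] := xget 0 [set l | cvgC f x^'+ l].
Definition jump f x : R[i] := rval f x - lval f x.

Lemma lvalP f x : (exists l, cvgC f x^'- l) -> cvgC f x^'- (lval f x).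
Proof. by move=> [l fl]; exact: (@xgetPex _ 0 [set l | cvgC f x^'- l] (ex_intro _ l fl)). Qed.

Lemma rvalP f x : (exists l, cvgC f x^'+ l) -> cvgC f x^'+ (rval f x).
Proof. by move=> [l fl]; exact: (@xgetPex _ 0 [set l | cvgC f x^'+ l] (ex_intro _ l fl)). Qed.

Lemma lval_eq f x l : cvgC f x^'- l -> lval f x = l.
Proof. by move=> fl; apply: (ccvg_unique (lvalP (ex_intro _ l fl)) fl). Qed.

Lemma rval_eq f x l : cvgC f x^'+ l -> rval f x = l.
Proof. by move=> fl; apply: (ccvg_unique (rvalP (ex_intro _ l fl)) fl). Qed.

Lemma ccvg_left f x l : ccvg (nbhs x) f l -> cvgC f x^'- l.
Proof. by move=> [f1 f2]; split; exact: cvg_at_left_filter. Qed.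

Lemma ccvg_right f x l : ccvg (nbhs x) f l -> cvgC f x^'+ l.
Proof. by move=> [f1 f2]; split; exact: cvg_at_right_filter. Qed.

Lemma lval_cdable f x : cdable f x -> lval f x = f x.
Proof. by move=> /cdable_ccvg/ccvg_left/lval_eq. Qed.

Lemma rval_cdable f x : cdable f x -> rval f x = f x.
Proof. by move=> /cdable_ccvg/ccvg_right/rval_eq. Qed.

Lemma pws_cdable s f n x : pws s f -> x \notin s -> cdable (derivC n f) x.
Proof. by move=> [/smooth_onE fs _] xs; exact: fs. Qed.

Lemma jump_notin s f n x : pws s f -> x \notin s -> jump (derivC n f) x = 0.
Proof.
by move=> fs xs; rewrite /jump rval_cdable ?lval_cdable ?subrr //; exact: (pws_cdable n fs xs).
Qed.

Lemma piecewise_smoothP f : piecewise_smooth f -> exists2 s, uniq s & pws s f.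
Proof.
move=> [s [fs fl]]; exists (undup s); first exact: undup_uniq.
have fs' : smooth_on [set x | x \notin undup s] f.
  by apply: smooth_on_sub fs => x /=; rewrite mem_undup.
split => // n x; have [xs|xs] := boolP (x \in s); first exact: fl.
have cx : cdable (derivC n f) x by apply: (smooth_onE _ _).1 fs n x xs.
have /cdable_ccvg cc := cx.
by split; exists (derivC n f x); [exact: ccvg_left|exact: ccvg_right].
Qed.

Lemma pws_piecewise_smooth s f : pws s f -> piecewise_smooth f.
Proof. by move=> [fs fl]; exists s; split => // n x _; exact: fl. Qed.

Lemma pws_sub s s' f : {subset s <= s'} -> pws s f -> pws s' f.
Proof.
move=> ss' [fs fl]; split => //; apply: smooth_on_sub fs => x /=.
by apply: contra; exact: ss'.
Qed.

Lemma pws_derivC s k f : pws s f -> pws s (derivC k f).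
Proof.
move=> [fs fl]; split; first exact: smooth_on_derivC.
by move=> n x; rewrite derivCD; exact: fl.
Qed.

Lemma pws_smooth f : smooth_on [set: R] f -> pws [::] f.
Proof.
move=> sf; split; first by apply: smooth_on_sub sf.
move=> n x; have /cdable_ccvg cc := smooth_onT_cdable n x sf.
by split; exists (derivC n f x); [exact: ccvg_left|exact: ccvg_right].
Qed.

Lemma pwsM s f g : pws s f -> pws s g -> pws s (fun x => f x * g x).
Proof.
move=> [fs fl] [gs gl]; split; first exact (@smooth_onM R [set x | x \notin s] f g (@open_notin s) fs gs).
have lz n y (ys : y \notin s) :=
  (@leibniz R [set x | x \notin s] f g (@open_notin s) fs gs n y ys).2.
move=> n x; split.
  exists (\sum_(k < n.+1) 'C(n, k)%:R * lval (derivC (n - k) f) x * lval (derivC k g) x).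
  apply: (@ccvg_near _ _ _ _ (fun y =>
    \sum_(k < n.+1) 'C(n, k)%:R * derivC (n - k) f y * derivC k g y)).
    by apply: filterS (near_left_notin s x) => y ys; rewrite lz.
  apply: ccvg_sum => k _; apply: ccvgM; last exact: (lvalP (gl k x).1).
  by apply: ccvgM; [exact: ccvg_cst|exact: (lvalP (fl (n - k)%N x).1)].
exists (\sum_(k < n.+1) 'C(n, k)%:R * rval (derivC (n - k) f) x * rval (derivC k g) x).
apply: (@ccvg_near _ _ _ _ (fun y =>
  \sum_(k < n.+1) 'C(n, k)%:R * derivC (n - k) f y * derivC k g y)).
  by apply: filterS (near_right_notin s x) => y ys; rewrite lz.
apply: ccvg_sum => k _; apply: ccvgM; last exact: (rvalP (gl k x).2).
by apply: ccvgM; [exact: ccvg_cst|exact: (rvalP (fl (n - k)%N x).2)].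
Qed.

Lemma cvg_bounded (Fl : set_system R) {FF : Filter Fl} (h : R -> R[i]) l :
  ccvg Fl h l -> exists B, \forall x \near Fl, normc (h x) <= B.
Proof.
move=> [/cvgrPdist_le/(_ 1 ltr01) h1 /cvgrPdist_le/(_ 1 ltr01) h2].
exists (`|complex.Re l| + 1 + (`|complex.Im l| + 1)).
apply: filterS2 h1 h2 => x h1 h2; apply: (le_trans (normc_le_ReIm _)); apply: lerD.
  by rewrite -lerBlDl (le_trans (lerB_dist _ _)) // distrC.
by rewrite -lerBlDl (le_trans (lerB_dist _ _)) // distrC.
Qed.

Lemma near_split x (P : R -> Prop) : (\forall y \near x^'-, P y) ->
  (\forall y \near x^'+, P y) -> P x -> \forall y \near x, P y.
Proof.
rewrite /at_left /at_right !near_withinE => l r px.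
apply: filterS2 l r => y l r; have [yx|yx|->//] := ltgtP y x; [exact: l|exact: r].
Qed.

Lemma pws_measurable s f (p : R[i] -> R) : pws s f ->
  (forall x, x \notin s -> {for x, continuous (p \o f)}) ->
  measurable_fun setT (p \o f).
Proof.
move=> fs cf.
have -> : [set: R] = [set x | x \notin s] `|` [set` s].
  by apply/seteqP; split => // x _ /=; case: (boolP (x \in s)); [right|left].
have ms (s' : seq R) : measurable [set` s'].
  have cs : countable [set` s'] by apply: finite_set_countable; exact: finite_seq.
  by apply: countable_measurable => //; exact: measurable_set1.
apply/measurable_funU => //.
  by apply: open_measurable; exact: open_notin.
split.
  apply: open_continuous_measurable_fun; first exact: open_notin.
  by move=> x; rewrite inE; exact: cf.
elim: s {fs cf} => [|x s IH].
  rewrite (_ : [set` _] = set0); first exact: measurable_fun_set0.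
  by apply/seteqP; split => y.
rewrite (_ : [set` _] = [set x] `|` [set` s]).
  by apply/measurable_funU => //; split => //; exact: measurable_fun_set1.
apply/seteqP; split => y /=; rewrite in_cons.
  by case/orP => [/eqP ->|]; [left|right].
by case=> [->|->]; rewrite ?eqxx ?orbT.
Qed.

(** Each point has a neighbourhood where [f] is bounded: the one-sided limits control both sides,
    and the value at the point, arbitrary on [s], is added to the bound. Compactness of the segment
    makes the bound uniform. *)
Lemma pws_locally_bounded s f : pws s f -> locally_bounded f.
Proof.
move=> fs.
have cx x : x \notin s -> ccvg (nbhs x) f (f x).
  by move=> xs; apply: cdable_ccvg; have := pws_cdable 0 fs xs; rewrite derivC0.
split.
- by apply: (@pws_measurable s f (@complex.Re R) fs) => x /cx[].
- by apply: (@pws_measurable s f (@complex.Im R) fs) => x /cx[].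
move=> a b; have /compact_near_coveringP := @segment_compact R a b.
move=> /(_ R (pinfty_nbhs R) (fun M x => normc (f x) <= M) _)[].
  move=> x _.
  have [] := fs.2 0%N x; rewrite derivC0 => -[l1 /cvg_bounded[B1 h1]] [l2 /cvg_bounded[B2 h2]].
  pose B := Num.max (Num.max B1 B2) (normc (f x)).
  have hB : \forall y \near x, normc (f y) <= B.
    apply: near_split.
    - by apply: filterS h1 => y; rewrite /B !le_max => ->.
    - by apply: filterS h2 => y; rewrite /B !le_max => ->; rewrite orbT.
    - by rewrite /B !le_max lexx !orbT.
  exists ([set y | normc (f y) <= B], [set M | B <= M]) => /=.
    by split => //; apply: nbhs_pinfty_ge; exact: num_real.
  by move=> [y M] /= [h1' h2']; exact: le_trans h2'.
move=> M [_ hM]; have := hM (`|M| + 1); rewrite (le_lt_trans (ler_norm M)) ?ltrDl // => /(_ isT) h.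
exists (`|M| + 1); first by rewrite addr_ge0.
by move=> x xab; apply: h; rewrite /= in_itv.
Qed.

Lemma testfun_locally_bounded t n : locally_bounded (derivC n t).
Proof. exact: pws_locally_bounded (pws_derivC n (pws_smooth (testfun_smooth t))). Qed.

End PiecewiseSmooth.

(** * Integration by parts across jumps *)

Section JumpFormula.
Variable R : realType.
Notation mu := (@lebesgue_measure R).
Notation normc := Normc.normc.
Implicit Types (f g : R -> R[i]) (t : testfun R) (s : seq R) (x : R).

(** Extending [u] and [v] by their limits at [a] and [b] yields functions continuous on the closed
    interval, to which the fundamental theorem of calculus applies. *)
Lemma FTC_one_sided_limits (u v : R -> R) (a b A B A' B' : R) : a < b ->
  (forall x, a < x < b -> derivable u x 1 /\ derive1 u x = v x) ->
  (forall x, a < x < b -> {for x, continuous v}) ->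
  u @ a^'+ --> A -> u @ b^'- --> B -> v @ a^'+ --> A' -> v @ b^'- --> B' ->
  \int[mu]_(x in `]a, b[) v x = B - A.
Proof.
move=> ab du cv ua ub va vb.
pose patch (w : R -> R) (P Q : R) x := if x <= a then P else if b <= x then Q else w x.
have patch_near w P Q x : a < x < b -> \forall y \near x, w y = patch w P Q y.
  move=> xab; have : nbhs x `]a, b[ by apply: near_in_itvoo; rewrite in_itv.
  by apply: filterS => y /=; rewrite in_itv /= /patch => /andP[/lt_geF -> /lt_geF ->].
have patch_a w P Q l : w @ a^'+ --> l -> patch w P Q @ a^'+ --> l.
  move=> wl; apply: cvg_trans wl; apply: near_eq_cvg; near=> y.
  have ya : a < y by near: y; exact: nbhs_right_gt.
  have yb : y < b by near: y; exact: nbhs_right_lt.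
  by rewrite /patch lt_geF // lt_geF.
have patch_b w P Q l : w @ b^'- --> l -> patch w P Q @ b^'- --> l.
  move=> wl; apply: cvg_trans wl; apply: near_eq_cvg; near=> y.
  have ya : a < y by near: y; exact: nbhs_left_gt.
  have yb : y < b by near: y; exact: nbhs_left_lt.
  by rewrite /patch lt_geF // lt_geF.
have patchA w P Q : patch w P Q a = P by rewrite /patch lexx.
have patchB w P Q : patch w P Q b = Q by rewrite /patch lt_geF // lexx.
pose U := patch u A B; pose V := patch v A' B'.
have cV : {within `[a, b], continuous V}.
  apply/continuous_within_itvP => //; split.
  - move=> x; rewrite in_itv /= => xab.
    have nE := patch_near v A' B' x xab; rewrite /V /continuous_at -(nbhs_singleton nE).
    by apply: cvg_trans (cv x xab); exact: near_eq_cvg.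
  - by rewrite /V patchA; exact: patch_a.
  - by rewrite /V patchB; exact: patch_b.
have dU : derivable_oo_LRcontinuous U a b.
  split.
  - move=> x; rewrite in_itv /= => xab.
    exact: near_eq_derivable (patch_near u A B x xab) (du x xab).1.
  - by rewrite /U patchA; exact: patch_a.
  - by rewrite /U patchB; exact: patch_b.
have UV : {in `]a, b[%R, derive1 U =1 V}.
  move=> x; rewrite in_itv /= => xab.
  rewrite derive1E -(near_eq_derive _ (patch_near u A B x xab)) -derive1E.
  by rewrite (du x xab).2 /V -(nbhs_singleton (patch_near v A' B' x xab)).
have Vi : mu.-integrable `[a, b] (EFin \o V).
  by apply: continuous_compact_integrable => //; exact: segment_compact.
have sub1 : `]a, b[ `<=` `[a, b :> R] by exact: subset_itv_oo_cc.
have sub2 : `]a, b] `<=` `[a, b :> R] by exact: subset_itv_oc_cc.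
transitivity (\int[mu]_(x in `[a, b]) V x).
  rewrite -Rintegral_itv_obnd_cbnd; last exact: integrableS Vi.
  rewrite -Rintegral_itv_bndo_bndc; last exact: integrableS Vi.
  apply: eq_Rintegral => x; rewrite inE /= in_itv /= => xab.
  by rewrite /V -(nbhs_singleton (patch_near v A' B' x xab)).
by rewrite /Rintegral (continuous_FTC2 ab cV dU UV) /= /U patchA patchB.
Unshelve. all: by end_near. Qed.

Lemma Rintegral_two_pieces (h : R -> R) (a x b : R) : a < x < b ->
  mu.-integrable setT (EFin \o h) -> (forall y, h y != 0 -> a < y < b) ->
  \int[mu]_(y in setT) h y = \int[mu]_(y in `]a, x[) h y + \int[mu]_(y in `]x, b[) h y.
Proof.
move=> /andP[ax xb] hi hab.
have iS (A : set R) : measurable A -> mu.-integrable A (EFin \o h).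
  by move=> mA; apply: integrableS hi.
have -> : \int[mu]_(y in setT) h y = \int[mu]_(y in `]a, b[) h y.
  rewrite [RHS]Rintegral_mkcond; apply: eq_Rintegral => y _; rewrite patchE mem_setE in_itv /=.
  by case: ifPn => // yab; apply/eqP; apply: contraNT yab => /hab.
rewrite [X in _ = X + _]Rintegral_itv_bndo_bndc; last exact: iS.
have U : `]a, b[%classic = `]a, x] `|` `]x, b[ :> set R.
  by rewrite -itv_bndbnd_setU // bnd_simp // ltW.
rewrite U Rintegral_setU //; first by apply: iS; exact: measurableU.
by apply/disj_setPLR => y /=; rewrite !in_itv /= => /andP[_ yx] /andP[]; rewrite ltNge yx.
Qed.

Lemma integralC_pieces g h (a x b : R) : a < x < b ->
  (forall y, y != x -> a < y < b -> [/\ cdable g y, derivC 1 g y = h y & cdable h y]) ->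
  cvgC g a^'+ 0 -> cvgC g b^'- 0 ->
  (exists l, cvgC g x^'- l) -> (exists l, cvgC g x^'+ l) ->
  (exists l, cvgC h a^'+ l) -> (exists l, cvgC h b^'- l) ->
  (exists l, cvgC h x^'- l) -> (exists l, cvgC h x^'+ l) ->
  cintegrable h -> (forall y, h y != 0 -> a < y < b) ->
  integralC h = lval g x - rval g x.
Proof.
move=> axb gh [ga1 ga2] [gb1 gb2] /lvalP[gl1 gl2] /rvalP[gr1 gr2] [la [ha1 ha2]] [lb [hb1 hb2]]
  [lx [hl1 hl2]] [rx [hr1 hr2]] [hi1 hi2] hab.
have /andP[ax xb] := axb.
have L y : a < y < x -> [/\ cdable g y, derivC 1 g y = h y & cdable h y].
  move=> /andP[ay yx]; apply: gh; first by rewrite lt_eqF.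
  by rewrite ay (lt_trans yx).
have Rr y : x < y < b -> [/\ cdable g y, derivC 1 g y = h y & cdable h y].
  move=> /andP[xy yb]; apply: gh; first by rewrite gt_eqF.
  by rewrite yb (lt_trans ax).
apply: complex_ReIm; rewrite ?cReD ?cImD ?cReN ?cImN /integralC /=.
  have hn y : reC h y != 0 -> a < y < b.
    by move=> hy; apply: hab; apply: contra_neq hy; rewrite /reC => ->.
  have D1 y : a < y < x -> derivable (reC g) y 1 /\ derive1 (reC g) y = reC h y.
    by move=> /L[[d _] E _]; split => //; rewrite [RHS]/reC -E.
  have D2 y : x < y < b -> derivable (reC g) y 1 /\ derive1 (reC g) y = reC h y.
    by move=> /Rr[[d _] E _]; split => //; rewrite [RHS]/reC -E.
  have C1 y : a < y < x -> {for y, continuous (reC h)} by move=> /L[_ _ /cdable_ccvg[p _]].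
  have C2 y : x < y < b -> {for y, continuous (reC h)} by move=> /Rr[_ _ /cdable_ccvg[p _]].
  have F1 := @FTC_one_sided_limits (reC g) (reC h) a x _ _ _ _ ax D1 C1 ga1 gl1 ha1 hl1.
  have F2 := @FTC_one_sided_limits (reC g) (reC h) x b _ _ _ _ xb D2 C2 gr1 gb1 hr1 hb1.
  by rewrite (Rintegral_two_pieces axb hi1 hn) F1 F2 /= subr0 sub0r.
have hn y : imC h y != 0 -> a < y < b.
  by move=> hy; apply: hab; apply: contra_neq hy; rewrite /imC => ->.
have D1 y : a < y < x -> derivable (imC g) y 1 /\ derive1 (imC g) y = imC h y.
  by move=> /L[[_ d] E _]; split => //; rewrite [RHS]/imC -E.
have D2 y : x < y < b -> derivable (imC g) y 1 /\ derive1 (imC g) y = imC h y.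
  by move=> /Rr[[_ d] E _]; split => //; rewrite [RHS]/imC -E.
have C1 y : a < y < x -> {for y, continuous (imC h)} by move=> /L[_ _ /cdable_ccvg[_ p]].
have C2 y : x < y < b -> {for y, continuous (imC h)} by move=> /Rr[_ _ /cdable_ccvg[_ p]].
have F1 := @FTC_one_sided_limits (imC g) (imC h) a x _ _ _ _ ax D1 C1 ga2 gl2 ha2 hl2.
have F2 := @FTC_one_sided_limits (imC g) (imC h) x b _ _ _ _ xb D2 C2 gr2 gb2 hr2 hb2.
by rewrite (Rintegral_two_pieces axb hi2 hn) F1 F2 /= subr0 sub0r.
Qed.

Lemma cintegrable_mul_testfun f t n : locally_bounded f ->
  cintegrable (fun x => f x * derivC n t x).
Proof.
move=> lf; have [a [b [_ tab]]] := testfun_itv t.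
apply: (@locally_bounded_cintegrable _ _ a b).
  exact: (locally_boundedM lf (testfun_locally_bounded t n)).
move=> x; apply: contra_neqT => xab; rewrite derivC_out ?mulr0 // => /tab /=.
by rewrite in_itv /= (negbTE xab).
Qed.

Lemma derivC_testfunD n t u (c : R[i]) x :
  derivC n (c *: t + u) x = c * derivC n t x + derivC n u x.
Proof.
have oT := @openT R.
have st := smooth_onZ c oT (testfun_smooth t).
have [_ E] := derivCD_on oT st (testfun_smooth u) n (x := x) Logic.I.
by rewrite -(derivCZ_on c oT (testfun_smooth t) n (x := x) Logic.I) -E.
Qed.

Lemma integralC_mul_linear f n : locally_bounded f ->
  forall (c : R[i]) t u, integralC (fun x => f x * derivC n (c *: t + u) x) =
    c * integralC (fun x => f x * derivC n t x) + integralC (fun x => f x * derivC n u x).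
Proof.
move=> lf c t u.
have -> : (fun x => f x * derivC n (c *: t + u) x) =
    (fun x => c * (f x * derivC n t x) + f x * derivC n u x).
  by apply/funext => x; rewrite derivC_testfunD; ring.
have it := cintegrable_mul_testfun t n lf.
rewrite integralCD ?integralCZ //; last exact: cintegrable_mul_testfun.
have [a [b [_ tab]]] := testfun_itv t.
apply: (@locally_bounded_cintegrable _ _ a b).
  apply: (@locally_boundedM _ (fun=> c)).
    exact: pws_locally_bounded (pws_smooth (@smooth_on_cst R setT c)).
  exact: (locally_boundedM lf (testfun_locally_bounded t n)).
move=> x; apply: contra_neqT => xab; rewrite derivC_out ?mulr0 // => /tab /=.
by rewrite in_itv /= (negbTE xab).
Qed.

Lemma big_seq_single (I : eqType) (s : seq I) (F : I -> R[i]) (x : I) : uniq s ->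
  (forall y, y \in s -> y != x -> F y = 0) ->
  \sum_(y <- s) F y = if x \in s then F x else 0.
Proof.
move=> us F0; case: ifPn => xs.
  rewrite (bigD1_seq x) //= big_seq_cond big1 ?addr0 // => y /andP[ys yx].
  exact: F0.
by rewrite big_seq big1 // => y ys; apply: F0 => //; apply: contraNneq xs => <-.
Qed.

(** Both sides are linear in [t], so by gluing [t] may be supported near one point [x], in an
    interval meeting [s] at most in [x]. There (f t)' is integrated on the two sides of [x]; the
    outer boundary terms vanish and the inner ones leave the jump. *)
Lemma jump_formula s f t : uniq s -> pws s f ->
  - integralC (fun x => f x * derivC 1 t x) =
  integralC (fun x => derivC 1 f x * t x) + \sum_(x <- s) jump f x * t x.
Proof.
move=> us fs; apply/eqP; rewrite eq_sym -subr_eq0 opprK; apply/eqP.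
have lf := pws_locally_bounded fs.
have lf' := pws_locally_bounded (pws_derivC 1 fs).
(* Writing [derivC 0 t] for [t] lets [integralC_mul_linear] serve both integrals. *)
pose L (t : testfun R) : R[i]^o := integralC (fun x => derivC 1 f x * derivC 0 t x) +
  \sum_(x <- s) jump f x * t x + integralC (fun x => f x * derivC 1 t x).
suff : L t = 0 by rewrite /L derivC0.
apply: gluing => [c u v|x].
  have -> : L (c *: u + v) = c * L u + L v; last by [].
  rewrite /L (integralC_mul_linear 0 lf') (integralC_mul_linear 1 lf).
  have -> : \sum_(x <- s) jump f x * (c *: u + v) x =
      c * \sum_(x <- s) jump f x * u x + \sum_(x <- s) jump f x * v x.
    rewrite big_distrr -big_split; apply: eq_bigr => y _.
    by rewrite testfunDE testfunZE mulrDr mulrCA.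
  by rewrite !mulrDr [LHS](AC (2*2*2) (1*3*5*(2*4*6))).
have [e e0 he] := near_punctured s x.
exists `]x - e, x + e[.
  by split; [exact: interval_open|rewrite /= in_itv /=; apply/andP; split; lra].
move=> {}t tU; pose g y := f y * t y.
pose h y := derivC 1 f y * derivC 0 t y + f y * derivC 1 t y.
have st := pws_sub (s := [::]) (s' := s) (fun _ => ltac:(done)) (pws_smooth (testfun_smooth t)).
have gs := pwsM fs st.
have tout y : ~ (x - e < y < x + e) -> ~ supp t y.
  by move=> ny /tU /=; rewrite in_itv.
have gh y : y \notin s -> derivC 1 g y = h y.
  move=> ys; have cf : cdable f y by have := pws_cdable 0 fs ys; rewrite derivC0.
  have ct : cdable t y by have := testfun_cdable t 0 y; rewrite derivC0.
  by rewrite (derivC1M cf ct) /h derivC0.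
have gl y : (exists l, cvgC g y^'- l) /\ (exists l, cvgC g y^'+ l).
  by have := gs.2 0%N y; rewrite derivC0.
have hl y : (exists l, cvgC h y^'- l) /\ (exists l, cvgC h y^'+ l).
  have [[l1 h1] [l2 h2]] := gs.2 1%N y; split; [exists l1|exists l2].
    by apply: ccvg_near h1; apply: filterS (near_left_notin s y) => z zs; rewrite gh.
  by apply: ccvg_near h2; apply: filterS (near_right_notin s y) => z zs; rewrite gh.
have g0 y : ~ (x - e < y < x + e) -> ccvg (nbhs y) g 0.
  move=> /tout ny; apply: (@ccvg_near _ _ _ _ (fun=> 0)); last exact: ccvg_cst.
  by apply: filterS (nbhs_nsupp ny) => z tz; rewrite /g tz mulr0.
have E : integralC h = lval g x - rval g x.
  apply: (@integralC_pieces g h (x - e) x (x + e)).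
  - by apply/andP; split; lra.
  - move=> y yx ye; have ys := he y yx ye; split.
    + by have := pws_cdable 0 gs ys; rewrite derivC0.
    + exact: gh.
    + have nE : \forall z \near y, derivC 1 g z = h z.
        have : nbhs y [set z | z \notin s] by apply: open_nbhs_nbhs; split => //; exact: open_notin.
        by apply: filterS => z; exact: gh.
      exact: near_eq_cdable nE (pws_cdable 1 gs ys).
  - by apply: ccvg_right; apply: g0; rewrite ltxx.
  - by apply: ccvg_left; apply: g0; rewrite ltxx andbF.
  - exact: (gl x).1.
  - exact: (gl x).2.
  - exact: (hl _).2.
  - exact: (hl _).1.
  - exact: (hl _).1.
  - exact: (hl _).2.
  - have [a [b [_ tab]]] := testfun_itv t.
    have [i1 i2] := cintegrable_mul_testfun t 0 lf'.
    have [j1 j2] := cintegrable_mul_testfun t 1 lf.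
    split.
      have -> : reC h = (fun y => reC (fun y => derivC 1 f y * derivC 0 t y) y +
          reC (fun y => f y * derivC 1 t y) y).
        by apply/funext => y; rewrite /h /reC cReD.
      by have := integrableD measurableT i1 j1; apply: eq_integrable.
    have -> : imC h = (fun y => imC (fun y => derivC 1 f y * derivC 0 t y) y +
        imC (fun y => f y * derivC 1 t y) y).
      by apply/funext => y; rewrite /h /imC cImD.
    by have := integrableD measurableT i2 j2; apply: eq_integrable.
  - move=> y; apply: contra_neqT => /negP/tout ny.
    by rewrite /h (derivC_out 0 ny) (derivC_out 1 ny) !mulr0 addr0.
have cx : ccvg (nbhs x) t (t x).
  by apply: cdable_ccvg; have := testfun_cdable t 0 x; rewrite derivC0.
have f0 := fs.2 0%N x; rewrite derivC0 in f0.
have lg : lval g x = lval f x * t x.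
  by apply: lval_eq; apply: (ccvgM (lvalP f0.1) (ccvg_left cx)).
have rg : rval g x = rval f x * t x.
  by apply: rval_eq; apply: (ccvgM (rvalP f0.2) (ccvg_right cx)).
have Sx : \sum_(y <- s) jump f y * t y = jump f x * t x.
  rewrite (big_seq_single (x := x)) //; last first.
    move=> y ys yx; rewrite (@supp_out _ t y) ?mulr0 //; apply: tout => ye.
    by have := he y yx ye; rewrite ys.
  by case: ifPn => // xs; have := jump_notin 0 fs xs; rewrite derivC0 => ->; rewrite mul0r.
rewrite /L Sx addrAC -integralCD; [|exact: cintegrable_mul_testfun..].
by rewrite E lg rg /jump mulrBl addrC addrA subrK subrr.
Qed.

End JumpFormula.

(** * The fundamental lemma of the calculus of variations *)

Section FundamentalLemma.
Variable R : realType.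
Notation mu := (@lebesgue_measure R).
Implicit Types (f g : R -> R[i]) (t : testfun R) (s : seq R) (x : R).

Lemma Rintegral_gt0 (k : R -> R) x : mu.-integrable setT (EFin \o k) ->
  (forall y, 0 <= k y) -> {for x, continuous k} -> 0 < k x ->
  0 < \int[mu]_(y in setT) k y.
Proof.
move=> ki k0 ck kx.
have : nbhs x [set y | k x / 2 < k y].
  by move/cvgrPdist_lt: ck => /(_ (k x / 2)) /(_ ltac:(lra)); apply: filterS => y /=;
    rewrite ltr_norml => /andP[_ h]; lra.
move=> /nbhs_ballP[e /= e0 he].
pose c : R -> R := cst (k x / 2) \_ `[x - e / 2, x + e / 2].
have cE y : c y = if x - e / 2 <= y <= x + e / 2 then k x / 2 else 0.
  by rewrite /c patchE mem_setE in_itv.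
have ci : mu.-integrable setT (EFin \o c).
  apply: (@integrable_supported _ _ (x - e / 2) (x + e / 2) (k x / 2)).
  - by apply/(measurable_restrictT _ _).1.
  - by move=> y; rewrite cE; case: ifP => _; rewrite ?normr0 ?ger0_norm //; lra.
  - move=> y; rewrite cE; case: ifPn => [|_]; last by rewrite eqxx.
    by [].
apply: (@lt_le_trans _ _ (\int[mu]_(y in setT) c y)).
  rewrite /c -Rintegral_mkcond Rintegral_cst //= lebesgue_measure_itv /= lte_fin.
  case: ifPn => [_|]; last by move=> /negP[]; lra.
  by rewrite /= mulr_gt0 //; lra.
apply: le_Rintegral => // y _; rewrite cE; case: ifPn => [/andP[y1 y2]|_]; last exact: k0.
by apply: ltW; apply: he; rewrite /ball /= ltr_norml; apply/andP; split; lra.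
Qed.

(** If the inequality failed at [x], it would fail on a neighbourhood, and a nonnegative bump
    supported there would give the two integrals different real parts. *)
Lemma fundamental_lemma_Re (U : set R) f g x : open U -> smooth_on U f -> smooth_on U g ->
  (forall t, supp t `<=` U ->
    integralC (fun y => f y * t y) = integralC (fun y => g y * t y)) ->
  U x -> complex.Re (f x) <= complex.Re (g x).
Proof.
move=> oU fU gU fg Ux; rewrite leNgt; apply/negP => lt_gf.
have cx (h : R -> R[i]) : smooth_on U h -> ccvg (nbhs x) h (h x).
  by move=> hU; apply: cdable_ccvg; have := (smooth_onE _ _).1 hU 0%N x Ux; rewrite derivC0.
have [cf _] := cx f fU; have [cg _] := cx g gU.
have : nbhs x [set y | U y /\ complex.Re (g y) < complex.Re (f y)].
  have h1 : \forall y \near x, U y by apply: open_nbhs_nbhs.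
  have h2 : \forall y \near x, 0 < complex.Re (f y) - complex.Re (g y).
    by apply: (cvgr_gt _ (cvgB cf cg)); rewrite subr_gt0.
  by apply: filterS2 h1 h2 => y; rewrite subr_gt0.
move=> /nbhs_ballP[e /= e0 he].
have eU y : x - e / 2 <= y <= x + e / 2 -> U y /\ complex.Re (g y) < complex.Re (f y).
  by move=> /andP[y1 y2]; apply: he; rewrite /ball /= ltr_norml; apply/andP; split; lra.
have [b [sb b0 bpos bsupp]] := @bump_ex R (x - e / 2) (x + e / 2) ltac:(lra).
have bs y : rC b y != 0 -> x - e / 2 <= y <= x + e / 2.
  move=> by0; have /bsupp/andP[/ltW -> /ltW ->] // : b y != 0.
  by apply: contra_neq by0; rewrite /rC => ->.
have [t tE] := testfun_ex sb bs.
have tU : supp t `<=` U.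
  have ti : supp t `<=` `[x - e / 2, x + e / 2].
    by apply: supp_itv => y; rewrite tE; exact: bs.
  by move=> y /ti /=; rewrite in_itv => /eU[].
(* [f] and [g] are arbitrary off [U]; as test functions the products are integrable and continuous
   on the whole line. *)
have [s1 s1E] := tmul_ex oU fU tU; have [s2 s2E] := tmul_ex oU gU tU.
have si (u : testfun R) : mu.-integrable setT (EFin \o reC u) /\ cintegrable u.
  have [c [d [_ ucd]]] := testfun_itv u.
  have lu := testfun_locally_bounded u 0; rewrite derivC0 in lu.
  have iu : cintegrable u by apply: locally_bounded_cintegrable lu (testfun_off ucd).
  by split => //; case: iu.
pose k y := reC s1 y - reC s2 y.
have kE y : k y = (complex.Re (f y) - complex.Re (g y)) * b y.
  by rewrite /k /reC s1E s2E tE /rC !cReM /= !mulr0 !subr0 mulrBl.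
have ck : {for x, continuous k}.
  have cu (u : testfun R) : {for x, continuous (reC u)}.
    by have := testfun_cdable u 0 x; rewrite derivC0 => /cdable_ccvg[].
  exact: cvgB (cu s1) (cu s2).
have ki : mu.-integrable setT (EFin \o k).
  have := integrableB measurableT (si s1).1 (si s2).1.
  by apply: eq_integrable.
have : 0 < \int[mu]_(y in setT) k y.
  apply: (@Rintegral_gt0 k x) => //.
    move=> y; rewrite kE; have [-> |by0] := eqVneq (b y) 0; first by rewrite mulr0.
    have /bsupp/andP[y1 y2] := by0.
    rewrite mulr_ge0 // subr_ge0 ltW //; have [] := eU y; first by rewrite !ltW.
    by [].
  rewrite kE mulr_gt0 ?subr_gt0 //; apply: bpos; apply/andP; split; lra.
rewrite /k (RintegralB measurableT (si s1).1 (si s2).1).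
have : integralC s1 = integralC s2.
  by rewrite (eq_integralC s1E) (eq_integralC s2E) fg.
by rewrite /integralC => -[-> _]; rewrite subrr ltxx.
Qed.

Lemma fundamental_lemma (U : set R) f g x : open U -> smooth_on U f -> smooth_on U g ->
  (forall t, supp t `<=` U ->
    integralC (fun y => f y * t y) = integralC (fun y => g y * t y)) ->
  U x -> f x = g x.
Proof.
have half f' g' : open U -> smooth_on U f' -> smooth_on U g' ->
    (forall t, supp t `<=` U ->
      integralC (fun y => f' y * t y) = integralC (fun y => g' y * t y)) ->
    U x -> complex.Re (f' x) = complex.Re (g' x).
  move=> oU fU gU fg Ux; apply/eqP; rewrite eq_le !(@fundamental_lemma_Re U) //.
  by move=> t tU; rewrite fg.
move=> oU fU gU fg Ux; apply: complex_ReIm; first exact: half.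
(* Multiplication by -i turns imaginary parts into real parts. *)
pose k : R[i] := Complex 0 (- 1).
have : complex.Re (k * f x) = complex.Re (k * g x).
  apply: (half (fun y => k * f y) (fun y => k * g y) oU (smooth_onZ k oU fU)
    (smooth_onZ k oU gU) _ Ux).
  move=> t tU; have [t' t'E] := tmul_ex oU (@smooth_on_cst R U (k)) tU.
  have t'U : supp t' `<=` U by apply: (subset_trans (supp_mul t'E)).
  have := fg t' t'U.
  have E (h : R -> R[i]) : integralC (fun y => h y * t' y) = integralC (fun y => k * h y * t y).
    by apply: eq_integralC => y; rewrite t'E mulrCA mulrA.
  by rewrite !E.
have kE z : complex.Re (k * z) = complex.Im z by rewrite cReM /= mul0r mulN1r sub0r opprK.
by rewrite !kE.
Qed.

End FundamentalLemma.
(** * Normal form of the distributions in classA *)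

Section NormalForm.
Variable R : realType.
Notation normc := Normc.normc.
Implicit Types (f g : R -> R[i]) (t : testfun R) (s : seq R) (x : R) (c : R -> nat -> R[i]).

(** Coefficients are relative to the functional t^(j)(x), which is (-1)^j times the j-th derivative
    of the Dirac measure; tests then read them off without signs. *)
Definition deltas s n c : functional R :=
  fun t => \sum_(x <- s) \sum_(j < n) c x j * derivC j t x.

Definition nf s n c f : functional R := fun t => regular f t + deltas s n c t.

Definition cof n f x j : R[i] :=
  if (j < n)%N then (-1) ^+ j * jump (derivC (n.-1 - j) f) x else 0.

(** The slack [n <= m] pads with zero coefficients, so that derivatives of different orders get the
    common length that [star_nf] asks for. *)
Lemma Dn_nf s f n m : uniq s -> pws s f -> (n <= m)%N ->
  Dn n (regular f) = nf s m (cof n f) (derivC n f).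
Proof.
move=> us fs; elim: n => [|n IH] nm; apply/funext => t.
  rewrite /nf derivC0 /deltas big1 ?addr0 // => x _.
  by rewrite big1 // => j _; rewrite /cof mul0r.
rewrite /Dn iterS -/(Dn n _) IH ?(ltnW nm) // /Ddist /nf opprD.
have -> : - regular (derivC n f) (test_derive t) =
    integralC (fun x => derivC n.+1 f x * t x) + \sum_(x <- s) jump (derivC n f) x * t x.
  exact: (jump_formula t us (pws_derivC n fs)).
rewrite -addrA; congr (_ + _).
rewrite /deltas -sumrN -big_split /=; apply: eq_bigr => x _.
case: m nm {IH} => // m nm.
rewrite big_ord_recr /= [X in - (_ + X * _)]/cof ltnNge -ltnS nm /= mul0r addr0.
rewrite [in RHS]big_ord_recl [X in _ = X * _ + _]/cof ltn0Sn expr0 mul1r subn0 derivC0; congr (_ + _).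
rewrite -sumrN; apply: eq_bigr => j _; rewrite lift0.
have -> : derivC j (test_derive t) x = derivC j.+1 t x by rewrite -addn1 -derivCD.
rewrite -mulNr; congr (_ * _).
rewrite /cof ltnS; case: ifPn => _; last by rewrite oppr0.
rewrite exprS mulN1r mulNr; congr (- (_ * jump (derivC _ f) x)).
by rewrite -subn1 subnAC subn1 -subnS ?subSS.
Qed.

Lemma compact_itv (K : set R) : compact K -> exists a b : R, a < b /\ K `<=` `[a, b].
Proof.
move=> /compact_bounded[M [Mr]].
move=> /(_ (`|M| + 1)); rewrite (le_lt_trans (ler_norm M)) ?ltrDl // => /(_ isT) h.
exists (- (`|M| + 1)), (`|M| + 1); split.
  by have := normr_ge0 M; lra.
move=> x /h /=; rewrite ler_norml => /andP[x1 x2].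
by rewrite in_itv /= x1 x2.
Qed.

Lemma dist_regular f : locally_bounded f -> is_distribution (regular f).
Proof.
move=> lf; split.
  move=> c t u; have := integralC_mul_linear 0 lf c t u; rewrite !derivC0.
  exact.
move=> K /compact_itv[a [b [ab Kab]]].
have [_ _ /(_ a b)[C C0 fC]] := lf.
exists 0%N, (2 * (b - a) * C) => t B tK tB.
have tB0 x : normc (t x) <= B by have := tB 0%N x (leqnn _); rewrite derivC0.
have tab := testfun_off (subset_trans tK Kab).
have B0 : 0 <= B := le_trans (normc_ge0 _) (tB0 0).
rewrite -mulrA; apply: (normc_integralC_le (ltW ab)).
- exact: mulr_ge0.
- have := locally_boundedM lf (testfun_locally_bounded t 0); rewrite derivC0.
  exact: locally_bounded_cmeasurable.
- move=> x; have [->|tx] := eqVneq (t x) 0; first by rewrite mulr0 Normc.normc0 mulr_ge0.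
  by rewrite Normc.normcM ler_pM ?normc_ge0 // fC // tab.
- by move=> x; rewrite mulf_eq0 negb_or => /andP[_]; exact: tab.
Qed.

Lemma deltas_linear s n c (k : R[i]) t u :
  deltas s n c (k *: t + u) = k * deltas s n c t + deltas s n c u.
Proof.
rewrite /deltas big_distrr -big_split; apply: eq_bigr => x _.
rewrite big_distrr -big_split; apply: eq_bigr => j _ /=.
by rewrite derivC_testfunD mulrDr mulrCA.
Qed.

Lemma dist_deltas s n c : is_distribution (deltas s n c).
Proof.
split; first exact: deltas_linear.
move=> K _; exists n, (\sum_(x <- s) \sum_(j < n) normc (c x j)) => t B _ tB.
rewrite /deltas (le_trans (normc_sum _ _)) // big_distrl ler_sum // => x _.
rewrite (le_trans (normc_sum _ _)) // big_distrl ler_sum // => j _ /=.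
rewrite Normc.normcM ler_wpM2l ?normc_ge0 // tB // ltnW //.
Qed.

Lemma distD (F G : functional R) : is_distribution F -> is_distribution G ->
  is_distribution (fun t => F t + G t).
Proof.
move=> [linF Fb] [linG Gb]; split.
  by move=> k t u; rewrite linF linG scalerDr addrACA.
move=> K cK; have [N1 [c1 h1]] := Fb K cK; have [N2 [c2 h2]] := Gb K cK.
exists (maxn N1 N2), (c1 + c2) => t B tK tB.
rewrite (le_trans (normcD _ _)) // mulrDl lerD //.
  by apply: h1 => // n x nN; apply: tB; rewrite leq_max nN.
by apply: h2 => // n x nN; apply: tB; rewrite leq_max nN orbT.
Qed.

Lemma nf_dist s n c f : pws s f -> is_distribution (nf s n c f).
Proof.
by move=> fs; apply: distD; [exact: dist_regular (pws_locally_bounded fs)|exact: dist_deltas].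
Qed.

Lemma deltas_out s n c t : (forall x, x \in s -> ~ supp t x) -> deltas s n c t = 0.
Proof.
move=> h; rewrite /deltas big_seq big1 // => x xs; rewrite big1 // => j _.
by rewrite derivC_out ?mulr0 //; exact: h.
Qed.

Lemma nf_agree s n c f : agree_on [set x | x \notin s] (nf s n c f) (regular f).
Proof.
move=> t tU; rewrite /nf deltas_out ?addr0 // => x xs /tU /=.
by rewrite xs.
Qed.

Lemma deltas_map s n c (e : R) t : deltas [seq x - e | x <- s] n c t =
  \sum_(x <- s) \sum_(j < n) c (x - e) j * derivC j t (x - e).
Proof. by rewrite /deltas big_map. Qed.

End NormalForm.

(** * The star product *)

Section HormanderProduct.
Variable R : realType.
Notation normc := Normc.normc.
Implicit Types (f g : R -> R[i]) (t : testfun R) (s : seq R) (x e : R) (c : R -> nat -> R[i]).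

(* The coefficients of the product of the point distribution with coefficients c
   by a function g that is smooth near the points. *)
Definition leib n c g x k : R[i] :=
  \sum_(j < n) c x j * 'C(j, k)%:R * derivC (j - k) g x.

Lemma pws_cmeasurable s f : pws s f -> cmeasurable f.
Proof. by move/pws_locally_bounded/locally_bounded_cmeasurable. Qed.

Lemma deltas_smooth_mul s s' n c g t (u : testfun R) :
  (forall x, x \in s -> x \notin s') -> pws s' g -> (forall x, u x = g x * t x) ->
  deltas s n c u = deltas s n (leib n c g) t.
Proof.
move=> ss' gs' uE; rewrite /deltas big_seq [RHS]big_seq; apply: eq_bigr => x xs.
have st : smooth_on [set y | y \notin s'] t by apply: smooth_on_sub (testfun_smooth t).
have E (j : 'I_n) : c x j * derivC j u x =
    \sum_(k < n) c x j * ('C(j, k)%:R * derivC (j - k) g x * derivC k t x).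
  have -> : derivC j u = derivC j (fun y => g y * t y) by congr derivC; apply/funext.
  by rewrite (leibniz_small (@open_notin R s') gs'.1 st (ss' x xs) (ltn_ord j)) big_distrr.
rewrite (eq_bigr _ (fun j _ => E j)) exchange_big; apply: eq_bigr => k _.
by rewrite /leib big_distrl; apply: eq_bigr => j _ /=; rewrite !mulrA.
Qed.

(** To be read with [s] and [s'] disjoint: each function is then smooth at the points carrying the
    coefficients of the other factor, and [leib] uses its actual derivatives. *)
Definition nf_prod s s' n a b f g : functional R :=
  fun t => regular (fun x => f x * g x) t + (deltas s n (leib n a g) t + deltas s' n (leib n b f) t).

Lemma nf_prodC s s' n a b f g : nf_prod s s' n a b f g = nf_prod s' s n b a g f.
Proof.
apply/funext => t; rewrite /nf_prod [X in _ = _ + X]addrC; congr (_ + _).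
by apply: eq_integralC => x; rewrite [X in _ = X * _]mulrC.
Qed.

Lemma nf_prodE s s' n a b f g t (u : testfun R) :
  (forall x, x \in s -> x \notin s') -> pws s' g ->
  supp t `<=` [set x | x \notin s'] -> (forall x, u x = g x * t x) ->
  nf_prod s s' n a b f g t = nf s n a f u.
Proof.
move=> ss' gs' ts' uE; rewrite /nf_prod /nf (deltas_smooth_mul _ _ ss' gs' uE).
rewrite [X in _ + (_ + X)]deltas_out ?addr0; last first.
  by move=> x xs' /ts' /=; rewrite xs'.
by congr (_ + _); apply: eq_integralC => x; rewrite uE mulrA.
Qed.

Lemma hormander_nf s s' n a b f g : (forall x, x \in s -> x \notin s') ->
  pws s f -> pws s' g ->
  is_hormander_product (nf s n a f) (nf s' n b g) (nf_prod s s' n a b f g).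
Proof.
move=> ss' fs gs'; split.
  apply: distD; last by apply: distD; exact: dist_deltas.
  exact: dist_regular (locally_boundedM (pws_locally_bounded fs) (pws_locally_bounded gs')).
(* At a point of [s'] the first factor is the smooth one; at any other point the second is. *)
move=> x; have [xs'|xs'] := boolP (x \in s').
  have s's y : y \in s' -> y \notin s by move=> ys'; apply: contraL ys'; exact: ss'.
  exists [set y | y \notin s], f; split; [split; [exact: open_notin|exact: s's]|exact: fs.1|left].
  split; first exact: nf_agree.
  by move=> t u ts uE; rewrite nf_prodC; exact: nf_prodE.
exists [set y | y \notin s'], g; split; [split; [exact: open_notin|exact: xs']|exact: gs'.1|right].
split; first exact: nf_agree.
by move=> t u ts uE; exact: nf_prodE.
Qed.

(** By gluing it suffices to compare near each point. If both products treat the same factor as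
    smooth, the two smooth functions agree by the fundamental lemma; if they treat different factors
    as smooth, both values are the integral of f g t. *)
Lemma hormander_unique (F G P Q : functional R) :
  is_hormander_product F G P -> is_hormander_product F G Q -> P = Q.
Proof.
move=> [[linP _] hP] [[linQ _] hQ].
pose L (t : testfun R) : R[i]^o := P t - Q t.
suff L0 t : L t = 0 by apply/funext => t; apply/eqP; rewrite -subr_eq0; apply/eqP; exact: L0.
apply: gluing => [k u v|x].
  by rewrite /L linP linQ opprD addrACA scalerBr.
have [U [f [[oU Ux] fU hU]]] := hP x; have [V [g [[oV Vx] gV hV]]] := hQ x.
have oUV : open (U `&` V) by exact: openI.
exists (U `&` V) => //= {}t tUV.
have tU : supp t `<=` U by move=> y /tUV[].
have tV : supp t `<=` V by move=> y /tUV[].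
have [u uE] := tmul_ex oU fU tU; have [v vE] := tmul_ex oV gV tV.
have agree (H : functional R) : agree_on U H (regular f) -> agree_on V H (regular g) -> u = v.
  move=> Hf Hg; apply: testfun_ext => y; rewrite uE vE.
  have [ty|ty] := pselect (supp t y); last by rewrite (supp_out ty) !mulr0.
  congr (_ * _); apply: (@fundamental_lemma R (U `&` V)) => //; last exact: tUV.
  - exact: smooth_on_sub fU.
  - exact: smooth_on_sub gV.
  - move=> w wUV; have := Hf w (fun y wy => (wUV y wy).1).
    by rewrite (Hg w (fun y wy => (wUV y wy).2)).
have cross (H K : functional R) : agree_on U H (regular f) -> agree_on V K (regular g) ->
    K u = H v.
  move=> Hf Kg; rewrite Kg; last exact: subset_trans (supp_mul uE) tV.
  rewrite Hf; last exact: subset_trans (supp_mul vE) tU.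
  by apply: eq_integralC => y; rewrite uE vE; ring.
rewrite /L; apply/eqP; rewrite subr_eq0; apply/eqP.
case: hU => -[AU PU]; case: hV => -[AV QV]; rewrite (PU t u tU uE) (QV t v tV vE).
- by rewrite (agree F).
- exact: (cross F G).
- by apply: (cross G F).
- by rewrite (agree G).
Qed.


Lemma shift_right x : (x + e) @[e --> 0^'+] --> x^'+.
Proof.
move=> A [r /= r0 hA]; exists r => //= e; rewrite /ball /= sub0r normrN => er e0.
by apply: hA; rewrite /ball /= ?ltrDl // opprD addNKr normrN.
Qed.

Lemma shift_left x : (x - e) @[e --> 0^'+] --> x^'-.
Proof.
move=> A [r /= r0 hA]; exists r => //= e; rewrite /ball /= sub0r normrN => er e0.
apply: hA; rewrite /ball /= ?ltrBlDr ?ltrDl //.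
by rewrite opprB addrC subrK.
Qed.

Lemma derivC_shift n g e : derivC n (fun x => g (x + e)) = fun x => derivC n g (x + e).
Proof.
have -> : (fun x => g (x + e)) = (fun x => g (x - - e)).
  by apply/funext => x; rewrite opprK.
by rewrite derivC_translate; apply/funext => x; rewrite opprK.
Qed.

Lemma pws_shift s g e : pws s g -> pws [seq x - e | x <- s] (fun x => g (x + e)).
Proof.
move=> [gs gl]; split.
  have -> : (fun x => g (x + e)) = (fun x => g (x - - e)).
    by apply/funext => x; rewrite opprK.
  have := smooth_on_translate (e := - e) gs; apply: smooth_on_sub => x /=.
  apply: contra => xs; rewrite opprK in xs.
  by apply/mapP; exists (x + e) => //; rewrite addrK.
move=> n x; rewrite derivC_shift; have [[l1 h1] [l2 h2]] := gl n (x + e).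
split; [exists l1; apply: (ccvg_comp (Gl := (x + e)^'-) _ h1)|
        exists l2; apply: (ccvg_comp (Gl := (x + e)^'+) _ h2)].
  move=> A [r /= r0 hA]; exists r => //= y; rewrite /ball /= => xy yx.
  by apply: hA; rewrite /ball /= ?ltrD2r // opprD addrACA subrr addr0.
move=> A [r /= r0 hA]; exists r => //= y; rewrite /ball /= => xy yx.
by apply: hA; rewrite /ball /= ?ltrD2r // opprD addrACA subrr addr0.
Qed.


Lemma regular_translate s g e t : pws s g ->
  regular g (test_translate e t) = regular (fun x => g (x + e)) t.
Proof.
move=> gs; have lg := pws_locally_bounded (pws_shift e gs).
have lt := testfun_locally_bounded (test_translate e t) 0; rewrite derivC0 in lt.
have it := cintegrable_mul_testfun t 0 lg; rewrite derivC0 in it.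
pose h x := g x * test_translate e t x.
have hE x : h (x + e) = g (x + e) * t x by rewrite /h /= addrK.
rewrite /regular -[LHS]/(integralC h) -(integralC_translate (e := e)).
- by apply: eq_integralC => x; rewrite hE.
- exact: cmeasurableM (pws_cmeasurable gs) (locally_bounded_cmeasurable lt).
- by under eq_fun do rewrite hE.
Qed.

Lemma translate_nf s n b g e : pws s g ->
  translate e (nf s n b g) =
  nf [seq x - e | x <- s] n (fun y => b (y + e)) (fun x => g (x + e)).
Proof.
move=> gs; apply/funext => t; rewrite /translate /nf (regular_translate e t gs).
congr (_ + _); rewrite deltas_map /deltas; apply: eq_bigr => x _; apply: eq_bigr => j _.
by rewrite subrK (derivC_translate j t e).
Qed.

End HormanderProduct.

(** * The limit of the shifted products *)

Section StarProduct.
Variable R : realType.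
Notation normc := Normc.normc.
Implicit Types (f g : R -> R[i]) (t : testfun R) (s : seq R) (x e : R) (a b c : R -> nat -> R[i]).

(** The shift in G(x + e) makes the coefficients of F at [x] see [g] at x + e, whence right limits;
    the coefficients of G move to x - e and see [f] there, whence left limits. *)
Definition star_coef n a b f g x k : R[i] :=
  \sum_(j < n) (a x j * 'C(j, k)%:R * rval (derivC (j - k) g) x +
                b x j * 'C(j, k)%:R * lval (derivC (j - k) f) x).

Lemma testfun_ccvg t k x : ccvg (nbhs x) (derivC k t) (derivC k t x).
Proof. exact: cdable_ccvg (testfun_cdable t k x). Qed.

Lemma regular_shift_cvg s f g t : pws s f -> pws s g ->
  cvgC (fun e => regular (fun x => f x * g (x + e)) t) 0^'+ (regular (fun x => f x * g x) t).
Proof.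
move=> fs gs; have lf := pws_locally_bounded fs; have lg := pws_locally_bounded gs.
have lt := testfun_locally_bounded t 0; rewrite derivC0 in lt.
have [p [q [pq tpq]]] := testfun_itv t; have toff := testfun_off tpq.
apply: (cvgC_right_seq ltr01) => v v01 v0.
have [_ _ /(_ p q)[B1 B10 fB]] := lf.
(* The shifts stay below 1, so [g] is only evaluated on [p, q + 1]. *)
have [_ _ /(_ p (q + 1))[B2 B20 gB]] := lg.
have [B3 B30 tB] := locally_bounded_supported lt toff.
apply: (@integralC_dominated_cvg _ (fun n x => f x * g (x + v n) * t x) _ p q (B1 * B2 * B3) s).
- move=> n; apply: (@cmeasurableM _ (fun x => f x * g (x + v n))).
    exact: (cmeasurableM (pws_cmeasurable fs) (pws_cmeasurable (pws_shift (v n) gs))).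
  exact: locally_bounded_cmeasurable lt.
- apply: (@cmeasurableM _ (fun x => f x * g x)).
    exact: (cmeasurableM (pws_cmeasurable fs) (pws_cmeasurable gs)).
  exact: locally_bounded_cmeasurable lt.
- move=> x xs.
  apply: (@ccvgM _ _ _ _ (fun n => f x * g (x + v n))); last exact: ccvg_cst.
  apply: (@ccvgM _ _ _ _ (fun=> f x)); first exact: ccvg_cst.
  have cg : ccvg (nbhs x) g (g x).
    by apply: cdable_ccvg; have := pws_cdable 0 gs xs; rewrite derivC0.
  apply: (ccvg_comp (h := fun n => x + v n) _ cg).
  have xv : (x + v n) @[n --> \oo] --> x + 0 by apply: cvgD => //; exact: cvg_cst.
  by rewrite addr0 in xv.
- move=> n x; have [->|tx] := eqVneq (t x) 0.
    by rewrite mulr0 Normc.normc0 !mulr_ge0.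
  have xpq := toff x tx; have := v01 n => /andP[v1 v2].
  have xpq1 : p <= x + v n <= q + 1 by move: xpq => /andP[? ?]; apply/andP; split; lra.
  rewrite !Normc.normcM ler_pM ?mulr_ge0 ?normc_ge0 //.
  by rewrite ler_pM ?normc_ge0 // ?fB ?gB.
- by move=> n x; rewrite mulf_eq0 negb_or => /andP[_]; exact: toff.
Qed.

Lemma nf_prod_cvg s n a b f g t : pws s f -> pws s g ->
  cvgC (fun e => nf_prod s [seq x - e | x <- s] n a (fun y => b (y + e)) f
    (fun x => g (x + e)) t) 0^'+ (nf s n (star_coef n a b f g) (fun x => f x * g x) t).
Proof.
move=> fs gs.
pose c1 x k := \sum_(j < n) a x j * 'C(j, k)%:R * rval (derivC (j - k) g) x.
pose c2 x k := \sum_(j < n) b x j * 'C(j, k)%:R * lval (derivC (j - k) f) x.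
have -> : nf s n (star_coef n a b f g) (fun x => f x * g x) t =
    regular (fun x => f x * g x) t + (deltas s n c1 t + deltas s n c2 t).
  rewrite /nf; congr (_ + _); rewrite /deltas -big_split /=; apply: eq_bigr => x _.
  rewrite -big_split /=; apply: eq_bigr => k _ /=.
  by rewrite -mulrDl; congr (_ * _); rewrite /star_coef big_split.
apply: ccvgD; first exact: (regular_shift_cvg t fs gs).
apply: ccvgD.
  apply: ccvg_sum => x _; apply: ccvg_sum => k _; apply: ccvgM; last exact: ccvg_cst.
  apply: ccvg_sum => j _; apply: ccvgM; first exact: ccvg_cst.
  under eq_fun do rewrite derivC_shift.
  exact: (ccvg_comp (h := fun e => x + e) (@shift_right _ x) (rvalP (gs.2 _ x).2)).
under eq_fun do rewrite deltas_map.
apply: ccvg_sum => x _; apply: ccvg_sum => k _; apply: ccvgM; last first.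
  exact: (ccvg_comp (h := fun e => x - e) (@shift_left _ x) (ccvg_left (testfun_ccvg t k x))).
apply: ccvg_sum => j _; apply: ccvgM.
  by under eq_fun do rewrite subrK; exact: ccvg_cst.
exact: (ccvg_comp (h := fun e => x - e) (@shift_left _ x) (lvalP (fs.2 _ x).1)).
Qed.

Lemma shifts_disjoint s : \forall e \near 0^'+, forall x, x \in s -> x \notin [seq y - e | y <- s].
Proof.
have main (r : seq R) : \forall e \near (0 : R)^'+, forall x, x \in r -> x + e \notin s.
  elim: r => [|z r IH]; first by apply: nearW => e x.
  have hz : \forall e \near (0 : R)^'+, z + e \notin s.
    exact: (@shift_right _ z _ (near_right_notin s z)).
  by apply: filterS2 IH hz => e h1 h2 x; rewrite in_cons => /orP[/eqP ->//|]; exact: h1.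
apply: filterS (main s) => e he x xs; apply/mapP => -[y ys xy].
by have := he x xs; rewrite xy subrK ys.
Qed.

Lemma star_nf s n a b f g : pws s f -> pws s g ->
  star (nf s n a f) (nf s n b g) = nf s n (star_coef n a b f g) (fun x => f x * g x).
Proof.
move=> fs gs; set F := nf s n a f; set G := nf s n b g; set H := nf s n _ _.
pose P e := nf_prod s [seq x - e | x <- s] n a (fun y => b (y + e)) f (fun x => g (x + e)).
have hP : \forall e \near 0^'+, is_hormander_product F (translate e G) (P e).
  apply: filterS (shifts_disjoint s) => e dis.
  by rewrite /G translate_nf //; apply: hormander_nf => //; exact: pws_shift.
have PH t : cvgC (fun e => P e t) 0^'+ (H t) by exact: nf_prod_cvg.
have HS : is_star F G H.
  by split; [exact: nf_dist (pwsM fs gs)|exists P; split].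
(* The value chosen by [star] comes with a family [Q] of its own; uniqueness of the Hoermander
   product identifies [Q] with [P] for small e, hence also the limits. *)
have [_ [Q [hQ QS]]] := @xgetPex _ (0 : functional R) [set K | is_star F G K] (ex_intro _ H HS).
apply/funext => t; apply: (ccvg_unique (QS t)).
apply: ccvg_near (PH t); apply: filterS2 hP hQ => e h1 h2.
by rewrite (hormander_unique h1 h2).
Qed.

End StarProduct.

(** * Coefficients and order *)

Section CoefficientExtraction.
Variable R : realType.
Notation mu := (@lebesgue_measure R).
Notation normc := Normc.normc.
Implicit Types (f g h : R -> R[i]) (t : testfun R) (s : seq R) (x xi : R) (c : R -> nat -> R[i]).

(* Rescaling T keeps its k-th derivative at the point equal to 1 and does not
   increase the derivatives of order at most k. *)
Lemma coef_tests (k : nat) xi : exists tt : nat -> testfun R,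
  [/\ forall n y, tt n y != 0 -> xi - n.+1%:R^-1 <= y <= xi + n.+1%:R^-1,
      forall n j, derivC j (tt n) xi = (j == k)%:R &
      forall j, (j <= k)%N -> exists2 B, 0 <= B & forall n y, normc (derivC j (tt n) y) <= B].
Proof.
have [T [sT T1 Tk]] := @dual_monomial_ex R k.
have [T' T'E] := testfun_ex sT T1.
pose r n : R := n.+1%:R^-1.
have r0 n : 0 < r n by rewrite invr_gt0.
pose u n y := (r n ^+ k)%:C * T ((r n)^-1 * y + - ((r n)^-1 * xi)).
have sa n := smooth_affine ((r n)^-1) (- ((r n)^-1 * xi)) sT.
have su n : smooth_on [set: R] (u n) := smooth_onZ (r n ^+ k)%:C openT (sa n).
have uoff n y : u n y != 0 -> xi - r n <= y <= xi + r n.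
  rewrite mulf_eq0 negb_or => /andP[_ /T1]; rewrite -mulrN -mulrDr mulrC.
  move: (r n) (r0 n) => q q0 /andP[]; rewrite ler_pdivlMr // ler_pdivrMr // => y1 y2; apply/andP; split; lra.
pose tt n := sval (cid (testfun_ex (su n) (uoff n))).
have ttE n : (tt n : R -> R[i]) = u n := svalP (cid (testfun_ex (su n) (uoff n))).
have dE n j y : derivC j (tt n) y =
    (r n ^+ k)%:C * ((r n)^-1%:C ^+ j * derivC j T ((r n)^-1 * y + - ((r n)^-1 * xi))).
  by rewrite ttE (derivCZ_on _ openT (sa n)) // derivC_affine.
exists tt; split.
- by move=> n y; rewrite ttE; exact: uoff.
- move=> n j; rewrite dE subrr Tk; have [->|_] := eqVneq j k; last by rewrite !mulr0.
  by rewrite mulr1 -rmorphXn -rmorphM /= -exprMn mulfV ?gt_eqF // expr1n.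
- move=> j jk.
  have lT : locally_bounded (derivC j T) by rewrite -T'E; exact: testfun_locally_bounded.
  have Toff y : derivC j T y != 0 -> -1 <= y <= 1.
    apply: contra_neqT => y1; apply: derivC_out; rewrite -T'E => /supp_itv.
    rewrite T'E => /(_ (-1) 1 T1) /=.
    by rewrite in_itv /= (negbTE y1).
  have [B B0 TB] := locally_bounded_supported lT Toff.
  exists B => // n y; rewrite dE mulrA Normc.normcM -[leRHS]mul1r.
  rewrite ler_pM ?normc_ge0 // -rmorphXn -rmorphM /= expr0n addr0 sqrtr_sqr.
  rewrite ger0_norm ?mulr_ge0 ?exprn_ge0 ?invr_ge0 ?(ltW (r0 n)) //.
  rewrite -(subnK jk) exprD -mulrA -exprMn mulfV ?gt_eqF // expr1n mulr1.
  by rewrite exprn_ile1 ?(ltW (r0 n)) // invf_le1 // ler1n.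
Qed.

(** All supports lie in [xi - 1, xi + 1], where B (|Re h| + |Im h|) dominates, and they shrink to
    [xi], so the integrands tend to 0 at every other point. *)
Lemma locally_integrable_cvg0 h (u : nat -> R -> R[i]) xi B : locally_integrableC h ->
  (forall n, cmeasurable (u n)) -> (forall n y, normc (u n y) <= B) ->
  (forall n y, u n y != 0 -> xi - n.+1%:R^-1 <= y <= xi + n.+1%:R^-1) ->
  ccvg \oo (fun n => integralC (fun y => h y * u n y)) 0.
Proof.
move=> [[mh1 _ hi1] [mh2 _ hi2]] mu' uB uoff.
have B0 : 0 <= B := le_trans (normc_ge0 _) (uB 0%N 0).
pose K : set R := `[xi - 1, xi + 1].
have mK : measurable K by exact: measurable_itv.
have patchi (p : R -> R) : measurable_fun setT p -> (\int[mu]_(x in K) `|p x|%:E < +oo)%E ->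
    mu.-integrable setT (EFin \o ((fun x => `|p x|) \_ K)).
  move=> mp ip; rewrite -restrict_EFin; apply/(integrable_restrict _ _) => //.
  rewrite setTI.
  apply/integrableP; split.
    by apply/measurable_EFinP; apply: measurableT_comp => //; exact: measurable_funTS.
  apply: le_lt_trans ip; rewrite le_eqVlt; apply/orP; left; apply/eqP.
  by apply: eq_integral => x _ /=; rewrite normr_id.
have i1 := patchi _ mh1 (hi1 K (@subsetT _ _) (@segment_compact _ _ _)).
have i2 := patchi _ mh2 (hi2 K (@subsetT _ _) (@segment_compact _ _ _)).
pose G y := B * (((fun x => `|reC h x|) \_ K) y + ((fun x => `|imC h x|) \_ K) y).
have Gi : mu.-integrable setT (EFin \o G).
  by apply: integrableZ; have := integrableD measurableT i1 i2; apply: eq_integrable.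
have uK n y : u n y != 0 -> y \in K.
  move=> /uoff/andP[y1 y2]; have n1 : n.+1%:R^-1 <= 1 :> R by rewrite invf_le1 // ler1n.
  move: (n.+1%:R^-1 : R) n1 y1 y2 => q n1 y1 y2.
  by rewrite mem_setE in_itv /=; apply/andP; split; lra.
have GE n y : (`|reC h y| + `|imC h y|) * normc (u n y) <= G y.
  have [un|un] := eqVneq (u n y) 0.
    rewrite un Normc.normc0 mulr0 mulr_ge0 // addr_ge0 // patchE; case: ifP => //.
  by rewrite /G !patchE (uK n y un) mulrC ler_wpM2r ?addr_ge0.
have h0 y : y \notin [:: xi] -> \forall n \near \oo, u n y = 0.
  rewrite inE => yx; have d0 : 0 < `|y - xi| by rewrite normr_gt0 subr_eq0.
  near=> n; apply/eqP; apply/negPn/negP => /uoff /andP[y1 y2].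
  have : n.+1%:R^-1 < `|y - xi| by near: n; exact: near_infty_natSinv_lt (PosNum d0).
  move: (n.+1%:R^-1 : R) y1 y2 => q y1 y2.
  by apply/negP; rewrite -leNgt ler_norml; apply/andP; split; lra.
have mhu n : cmeasurable (fun y => h y * u n y) by apply: cmeasurableM.
have cv0 y (p : R[i] -> R) : p 0 = 0 -> y \notin [:: xi] ->
    (fun n => p (h y * u n y)) @ \oo --> (0 : R).
  move=> p0 /h0 hy; apply: (cvg_trans (near_eq_cvg _) (cvg_cst 0)).
  by apply: filterS hy => n /= ->; rewrite mulr0 p0.
have int0 : \int[mu]_(x in setT) (cst 0 x : R) = 0 by rewrite /Rintegral integral0.
split; rewrite /integralC /= -int0.
  apply: (@Rdominated_cvg _ (fun n => reC (fun y => h y * u n y)) (cst 0) G [:: xi]) => //.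
  - by move=> n; case: (mhu n).
  - by move=> y; apply: (cv0 y (@complex.Re R)).
  - move=> y n; apply: le_trans (GE n y); rewrite /reC cReM mulrDl.
    by rewrite (le_trans (ler_normB _ _)) // !normrM lerD // ler_wpM2l ?Re_le_normc ?Im_le_normc.
apply: (@Rdominated_cvg _ (fun n => imC (fun y => h y * u n y)) (cst 0) G [:: xi]) => //.
- by move=> n; case: (mhu n).
- by move=> y; apply: (cv0 y (@complex.Im R)).
- move=> y n; apply: le_trans (GE n y); rewrite /imC cImM mulrDl.
  by rewrite (le_trans (ler_normD _ _)) // !normrM lerD // ler_wpM2l ?Re_le_normc ?Im_le_normc.
Unshelve. all: by end_near. Qed.

Lemma pws_locally_integrable s f : pws s f -> locally_integrableC f.
Proof.
move=> fs; have [m1 m2 fb] := pws_locally_bounded fs.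
have main (p : R -> R) : measurable_fun setT p -> (forall y, `|p y| <= normc (f y)) ->
    locally_integrable [set: R] p.
  move=> mp pf; split => //; first exact: openT.
  move=> K _ cK; have [a [b [ab Kab]]] := compact_itv cK; have [B B0 fB] := fb a b.
  have mK : measurable K by exact: compact_measurable.
  have : mu.-integrable K (EFin \o p).
    apply: measurable_bounded_integrable => //.
    - exact: compact_finite_measure.
    - exact: measurable_funTS.
    - exists B; split; first exact: num_real.
      move=> M BM y Ky; apply: le_trans (ltW BM); apply: le_trans (pf y) _; apply: fB.
      by have := Kab y Ky; rewrite /= in_itv.
  by case/integrableP.
by split; apply: main => // y; [exact: Re_le_normc|exact: Im_le_normc].
Qed.

Lemma DnE p (F : functional R) t : Dn p F t = (-1) ^+ p * F (iter p (@test_derive R) t).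
Proof.
elim: p t => [|p IH] t; first by rewrite expr0 mul1r.
by rewrite /Dn iterS -/(Dn p F) /Ddist IH -iterSr exprS mulN1r mulNr.
Qed.

Lemma iter_test_derive p t : (iter p (@test_derive R) t : R -> R[i]) = derivC p t.
Proof.
elim: p => [|p IH]; first by rewrite derivC0.
by rewrite (derivCS p t) -IH.
Qed.

Section FixedTests.
Variables (k : nat) (xi : R) (tt : nat -> testfun R).
Hypothesis tt_supp : forall n y, tt n y != 0 -> xi - n.+1%:R^-1 <= y <= xi + n.+1%:R^-1.
Hypothesis tt_derive : forall n j, derivC j (tt n) xi = (j == k)%:R.
Hypothesis tt_bound : forall j, (j <= k)%N ->
  exists2 B, 0 <= B & forall n y, normc (derivC j (tt n) y) <= B.

Lemma tests_out n j y : ~~ (xi - n.+1%:R^-1 <= y <= xi + n.+1%:R^-1) -> derivC j (tt n) y = 0.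
Proof.
move=> yn; apply: derivC_out => /(supp_itv (@tt_supp n)) /=.
by rewrite in_itv /= (negbTE yn).
Qed.

Lemma integral_tests_cvg0 h j : locally_integrableC h -> (j <= k)%N ->
  ccvg \oo (fun n => integralC (fun y => h y * derivC j (tt n) y)) 0.
Proof.
move=> hl jk; have [B B0 tB] := tt_bound jk.
apply: (@locally_integrable_cvg0 h (fun n => derivC j (tt n)) xi B hl) => //.
  by move=> n; exact: locally_bounded_cmeasurable (testfun_locally_bounded _ _).
by move=> n y; apply: contra_neqT => /tests_out ->.
Qed.

(** The regular part tends to 0. Once the support is too small to meet another point of [s], the
    point part is exactly [c xi k], by duality of the tests with t^(k)(xi). *)
Lemma nf_tests_cvg s n c f : uniq s -> xi \in s -> (k < n)%N -> pws s f ->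
  ccvg \oo (fun i => nf s n c f (tt i)) (c xi k).
Proof.
move=> us xis kn fs; rewrite -[c xi k]add0r; apply: ccvgD.
  have := integral_tests_cvg0 (pws_locally_integrable fs) (leq0n k).
  by under eq_fun do rewrite derivC0.
apply: (@ccvg_near _ _ _ _ (fun=> c xi k)); last exact: ccvg_cst.
have [e e0 he] := near_punctured s xi.
near=> i.
have ie : i.+1%:R^-1 < e by near: i; exact: near_infty_natSinv_lt (PosNum e0).
rewrite /deltas (big_seq_single (x := xi)) // ?xis.
  rewrite (bigD1 (Ordinal kn)) //= tt_derive eqxx mulr1 big1 ?addr0 // => j jk.
  by rewrite tt_derive -(inj_eq val_inj) in jk *; rewrite (negbTE jk) mulr0.
move=> y ys yx; rewrite big1 // => j _; rewrite tests_out ?mulr0 //.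
apply/negP => /andP[y1 y2]; have := he y yx; rewrite ys => /(_ _)/negP; apply => //.
move: (i.+1%:R^-1 : R) ie y1 y2 => q ie y1 y2.
by apply/andP; split; lra.
Unshelve. all: by end_near. Qed.

(** All [p] derivatives are moved to the tests, whose derivatives up to order [k] are uniformly
    bounded; hence the condition [p <= k]. *)
Lemma Dn_tests_cvg0 p h : locally_integrableC h -> (p <= k)%N ->
  ccvg \oo (fun i => Dn p (regular h) (tt i)) 0.
Proof.
move=> hl pk; under eq_fun do rewrite DnE.
rewrite -(mulr0 ((-1) ^+ p)); apply: ccvgM; first exact: ccvg_cst.
under eq_fun do rewrite /regular iter_test_derive.
exact: integral_tests_cvg0.
Qed.

End FixedTests.

(** The link between order and coefficients: the same tests converge to [c xi k] and to 0. Since [h]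
    is only locally integrable, the two sides could not be compared as normal forms. *)
Lemma coef_vanish s n c f p h k xi : uniq s -> xi \in s -> (k < n)%N -> pws s f ->
  nf s n c f = Dn p (regular h) -> locally_integrableC h -> (p <= k)%N -> c xi k = 0.
Proof.
move=> us xis kn fs E hl pk; have [tt [t1 t2 t3]] := coef_tests k xi.
apply: (ccvg_unique (nf_tests_cvg t1 t2 t3 c us xis kn fs)).
by rewrite E; exact: (Dn_tests_cvg0 t1 t3 hl pk).
Qed.

(** Coefficients of order above [k] are absent and those below [k] carry the factor C(j, k) = 0, so
    no derivative of [f] or [g] enters. *)
Lemma star_coef_top m a b f g xi k : (k < m)%N ->
  (forall j, (k < j)%N -> a xi j = 0) -> (forall j, (k < j)%N -> b xi j = 0) ->
  star_coef m a b f g xi k = a xi k * rval g xi + b xi k * lval f xi.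
Proof.
move=> km ak bk; rewrite /star_coef (bigD1 (Ordinal km)) //= binn !mulr1 subnn !derivC0.
rewrite big1 ?addr0 // => j jk.
have [jk'|kj|jk'] := ltngtP j k.
- by rewrite bin_small // !mulr0 !mul0r addr0.
- by rewrite ak // bk // !mul0r addr0.
- by rewrite -(inj_eq val_inj) /= jk' eqxx in jk.
Qed.

End CoefficientExtraction.

(** * One-sided values and smooth extensions of normal forms *)

Section OneSidedValues.
Variable R : realType.
Implicit Types (f g : R -> R[i]) (t : testfun R) (s : seq R) (x xi : R) (c : R -> nat -> R[i])
  (U V : set R) (F G : functional R).

Lemma agree_onS U V F G : V `<=` U -> agree_on U F G -> agree_on V F G.
Proof. by move=> VU FG t tV; apply: FG; exact: subset_trans VU. Qed.

Lemma nf_agree_unique s n c f g U x : pws s f -> open U -> smooth_on U g ->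
  agree_on U (nf s n c f) (regular g) -> U x -> x \notin s -> g x = f x.
Proof.
move=> fs oU gU Ug Ux xs.
apply: (@fundamental_lemma R (U `&` [set y | y \notin s])) => //.
- by apply: openI => //; exact: open_notin.
- by apply: smooth_on_sub gU => y [].
- by apply: smooth_on_sub fs.1 => y [].
- move=> t ts.
  have := Ug t (fun y ty => (ts y ty).1).
  by rewrite (nf_agree n c f (fun y ty => (ts y ty).2)).
Qed.

(** The choice inside [left_value] is harmless: every admissible function coincides with [f] just to
    the left of [xi]. *)
Lemma left_value_nf s n c f xi : pws s f -> left_value (nf s n c f) xi = lval f xi.
Proof.
move=> fs; have [e e0 he] := near_punctured s xi.
have f0 := fs.2 0%N xi; rewrite derivC0 in f0.
set A := [set v | exists a g, [/\ a < xi, smooth_on `]a, xi[ g,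
    agree_on `]a, xi[ (nf s n c f) (regular g) & cvgC g xi^'- v]].
have sub : `]xi - e, xi[ `<=` [set y | y \notin s].
  move=> y /=; rewrite in_itv /= => /andP[y1 y2]; apply: he; first by rewrite lt_eqF.
  by rewrite y1 /= (lt_trans y2) // ltrDl.
have A0 : A (lval f xi).
  exists (xi - e), f; split.
  - by rewrite ltrBlDr ltrDl.
  - exact: smooth_on_sub sub fs.1.
  - exact: agree_onS sub (@nf_agree R s n c f).
  - exact: lvalP f0.1.
have [a [g [axi gs ag gv]]] := @xgetPex _ 0 A (ex_intro _ _ A0).
rewrite -[LHS]/(xget 0 A); apply/esym; apply: lval_eq; apply: ccvg_near gv.
near=> y.
have ys : y \notin s by near: y; exact: near_left_notin.
apply: (nf_agree_unique fs _ gs ag _ ys); first exact: interval_open.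
rewrite /= in_itv /=; apply/andP; split; near: y.
  exact: nbhs_left_gt.
exact: nbhs_left_lt.
Unshelve. all: by end_near. Qed.

Lemma right_value_nf s n c f xi : pws s f -> right_value (nf s n c f) xi = rval f xi.
Proof.
move=> fs; have [e e0 he] := near_punctured s xi.
have f0 := fs.2 0%N xi; rewrite derivC0 in f0.
set A := [set v | exists b g, [/\ xi < b, smooth_on `]xi, b[ g,
    agree_on `]xi, b[ (nf s n c f) (regular g) & cvgC g xi^'+ v]].
have sub : `]xi, xi + e[ `<=` [set y | y \notin s].
  move=> y /=; rewrite in_itv /= => /andP[y1 y2]; apply: he; first by rewrite gt_eqF.
  by rewrite y2 andbT (lt_trans _ y1) // ltrBlDr ltrDl.
have A0 : A (rval f xi).
  exists (xi + e), f; split.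
  - by rewrite ltrDl.
  - exact: smooth_on_sub sub fs.1.
  - exact: agree_onS sub (@nf_agree R s n c f).
  - exact: rvalP f0.2.
have [b [g [bxi gs ag gv]]] := @xgetPex _ 0 A (ex_intro _ _ A0).
rewrite -[LHS]/(xget 0 A); apply/esym; apply: rval_eq; apply: ccvg_near gv.
near=> y.
have ys : y \notin s by near: y; exact: near_right_notin.
apply: (nf_agree_unique fs _ gs ag _ ys); first exact: interval_open.
rewrite /= in_itv /=; apply/andP; split; near: y.
  exact: nbhs_right_gt.
exact: nbhs_right_lt.
Unshelve. all: by end_near. Qed.

Lemma nsing_near F x : ~ sing_supp F x -> \forall y \near x, ~ sing_supp F y.
Proof.
move=> /contrapT[U [f [[oU Ux] fU aU]]].
have : nbhs x U by apply: open_nbhs_nbhs.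
by apply: filterS => y Uy; apply; exists U, f.
Qed.

(** The interval is kept strictly inside one on which F is smooth, so its closure also lies there
    and the boundary limits are plain continuity. *)
Lemma smooth_extension_ex F x : ~ sing_supp F x -> exists2 d : R, 0 < d &
  forall e, 0 < e < d -> exists g, is_smooth_extension F `]x - e, x + e[ g.
Proof.
move=> /contrapT[U [g [oU gU aU]]].
have [d d0 dU] := open_nbhs_itv oU; exists d => // e /andP[e0 ed]; exists g.
have subU y : `[x - e, x + e]%classic y -> U y.
  by rewrite /= in_itv /= => /andP[y1 y2]; apply: dU; apply/andP; split; lra.
have sub : `]x - e, x + e[ `<=` U.
  by move=> y ye; apply: subU; exact: subset_itv_oo_cc ye.
have clU y : closure `]x - e, x + e[ y -> U y.
  have cl : closed (`[x - e, x + e]%classic : set R) by exact: interval_closed.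
  move=> yc; apply: subU; have -> := (closure_id _).1 cl.
  by apply: closureS yc; exact: subset_itv_oo_cc.
have cc n y : U y -> ccvg (nbhs y) (derivC n g) (derivC n g y).
  by move=> Uy; apply: cdable_ccvg; exact: (smooth_onE _ _).1 gU n y Uy.
have ccw n y : U y -> cvgC (derivC n g) (within `]x - e, x + e[ (nbhs y)) (derivC n g y).
  by move=> /(cc n)[h1 h2]; split; apply: cvg_within_filter.
split.
- exact: smooth_on_sub sub gU.
- exact: agree_onS sub aU.
- by move=> y /clU /(ccw 0%N); rewrite derivC0.
- by move=> n y /clU /(ccw n) h; exists (derivC n g y).
Qed.

(** [xi] is interior to [U], where the extension is continuous and equals [f] off [s]; both
    one-sided limits of [f] are therefore its value. This converts (C2') into the form of (C1'). *)
Lemma smooth_extension_value s n c f xi U :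
  pws s f -> open U -> U xi ->
  (exists g, is_smooth_extension (nf s n c f) U g) ->
  smooth_extension (nf s n c f) U xi = lval f xi /\
  smooth_extension (nf s n c f) U xi = rval f xi.
Proof.
move=> fs oU Uxi exg; set h := smooth_extension _ _.
have [hU ha _ _] : is_smooth_extension (nf s n c f) U h := xgetPex 0 exg.
have /cdable_ccvg hc : cdable h xi.
  by have := (smooth_onE _ _).1 hU 0%N xi Uxi; rewrite derivC0.
have nU : \forall y \near xi, U y by apply: open_nbhs_nbhs.
have hf y : y \notin s -> U y -> h y = f y.
  by move=> ys Uy; exact: (nf_agree_unique fs oU hU ha Uy ys).
split; apply/esym.
  apply: lval_eq; apply: ccvg_near (ccvg_left hc).
  have nl : \forall y \near xi^'-, U y by apply: cvg_within.
  by apply: filterS2 nl (near_left_notin s xi) => y Uy ys; exact: hf.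
apply: rval_eq; apply: ccvg_near (ccvg_right hc).
have nr : \forall y \near xi^'+, U y by apply: cvg_within.
by apply: filterS2 nr (near_right_notin s xi) => y Uy ys; exact: hf.
Qed.

End OneSidedValues.

(** * Shifting coefficients and lowering the number of derivatives *)

Section MainArgument.
Variable R : realType.
Implicit Types (f g : R -> R[i]) (t : testfun R) (s : seq R) (x xi : R) (F G : functional R).

Lemma Dn_Dn m n F : Dn m (Dn n F) = Dn (m + n) F.
Proof. by rewrite /Dn iterD. Qed.

Lemma ode_lhsE a0 a1 b0 b1 (w : R[i]) (phi : functional R) t :
  ode_lhs a0 a1 b0 b1 w phi t =
  \sum_(i < 3) 'C(2, i)%:R *
    (star (Dn i a0) (Dn (4 - i) phi) t + star (Dn (4 - i) phi) (Dn i a1) t)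
  - w ^+ 2 * (star b0 phi t + star phi b1 t).
Proof. by rewrite /ode_lhs !big_ord_recl !big_ord0. Qed.

(** Up to sign, the coefficient of order [j] of the i-th derivative is the coefficient of order j +
    2 - i of the second one: both are the same jump. A bound on the order of a_i'' thus controls a_i
    and a_i' as well. *)
Lemma cof_vanish n f xi p : (forall j, (p <= j)%N -> cof (2 + n) f xi j = 0) ->
  forall i j, (i <= 2)%N -> (p <= j)%N -> cof (i + n) f xi j = 0.
Proof.
move=> h i j i2 pj; rewrite /cof; case: ifPn => // jn.
have := h (j + (2 - i))%N (leq_trans pj (leq_addr _ _)).
rewrite /cof (_ : (j + (2 - i) < 2 + n)%N); last first.
  by rewrite -(subnK i2) addnC addnA addnK -addnA ltn_add2l || lia.
rewrite (_ : ((2 + n).-1 - (j + (2 - i)) = (i + n).-1 - j)%N); last by lia.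
by move=> /eqP; rewrite mulf_eq0 signr_eq0 /= => /eqP ->; rewrite mulr0.
Qed.

Lemma ord_le_ex n F : is_derivative_of_regular n F -> exists2 m, (m <= n)%N & has_ord F m.
Proof.
elim/ltn_ind: n => n IH Fn.
have [[m mn Fm]|h] := pselect (exists2 m, (m < n)%N & is_derivative_of_regular m F).
  by have [k km Fk] := IH m mn Fm; exists k => //; exact: leq_trans km (ltnW mn).
by exists n => //; split => // m mn Fm; apply: h; exists m.
Qed.

Lemma no_jump_reduce n f (phi : functional R) : piecewise_smooth f ->
  phi = Dn n.+1 (regular f) -> (forall x, jump f x = 0) -> phi = Dn n (regular (derivC 1 f)).
Proof.
move=> /piecewise_smoothP[s us fs] -> J0.
rewrite -addn1 -Dn_Dn (Dn_nf us fs (leqnn 1)); congr (Dn n _); apply/funext => t.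
rewrite /nf /deltas big1 ?addr0 // => x _; rewrite big_ord1 /cof /= (derivC0 f) J0.
by rewrite mulr0 mul0r.
Qed.

End MainArgument.

(** * The differential equation *)

Section NoJump.
Variable R : realType.
Implicit Types (f g : R -> R[i]) (t : testfun R) (s : seq R) (x xi : R) (F G : functional R).

(** Both conditions yield the same statement at an arbitrary point: (C1') on the singular set, and
    elsewhere (C2') on an interval around [xi] small enough to be regular and to carry smooth
    extensions of both coefficients. *)
Lemma leading_coef_neq0 s m c0 c1 g0 g1 (b0 b1 : functional R) (w : R[i]) xi :
  let a0 := nf s m c0 g0 in let a1 := nf s m c1 g1 in
  pws s g0 -> pws s g1 ->
  (forall x, singular_set a0 a1 b0 b1 w x -> left_value a0 x + right_value a1 x != 0) ->
  (forall U : set R, regular_open_interval a0 a1 b0 b1 w U ->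
    forall x : R, closure U x -> smooth_extension a0 U x + smooth_extension a1 U x != 0) ->
  lval g0 xi + rval g1 xi != 0.
Proof.
move=> a0 a1 g0s g1s C1 C2.
have [sx|nsx] := pselect (singular_set a0 a1 b0 b1 w xi).
  by have := C1 xi sx; rewrite left_value_nf // right_value_nf.
have h1 (j : 'I_3) : \forall y \near xi, ~ (sing_supp (Dn j a0) y \/ sing_supp (Dn j a1) y).
  have n0 : ~ sing_supp (Dn j a0) xi by move=> h; apply: nsx; left; exists j; left.
  have n1 : ~ sing_supp (Dn j a1) xi by move=> h; apply: nsx; left; exists j; right.
  by apply: filterS2 (nsing_near n0) (nsing_near n1) => y k0 k1 [].
have h2 : \forall y \near xi, ~ (sing_supp (w ^+ 2 *: b0) y \/ sing_supp (w ^+ 2 *: b1) y).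
  have n0 : ~ sing_supp (w ^+ 2 *: b0) xi by move=> h; apply: nsx; right; left.
  have n1 : ~ sing_supp (w ^+ 2 *: b1) xi by move=> h; apply: nsx; right; right.
  by apply: filterS2 (nsing_near n0) (nsing_near n1) => y k0 k1 [].
have : nbhs xi [set y | ~ singular_set a0 a1 b0 b1 w y].
  by apply: filterS2 (filter_forall _ h1) h2 => y k1 k2 [[j]|]; [exact: k1|exact: k2].
move=> /nbhs_ballP[d /= d0 hd].
have na0 : ~ sing_supp a0 xi by move=> h; apply: nsx; left; exists ord0; left.
have na1 : ~ sing_supp a1 xi by move=> h; apply: nsx; left; exists ord0; right.
have [e0 e00 ex0] := smooth_extension_ex na0; have [e1 e10 ex1] := smooth_extension_ex na1.
pose e := Num.min d (Num.min e0 e1) / 2.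
have [ed ee0 ee1] : [/\ 0 < e < d, 0 < e < e0 & 0 < e < e1].
  have p0 : 0 < Num.min d (Num.min e0 e1) by rewrite !lt_min d0 e00 e10.
  have le1 : Num.min d (Num.min e0 e1) <= d by rewrite ge_min lexx.
  have le2 : Num.min d (Num.min e0 e1) <= e0 by rewrite !ge_min lexx orbT.
  have le3 : Num.min d (Num.min e0 e1) <= e1 by rewrite !ge_min lexx !orbT.
  by rewrite /e; move: (Num.min d _) p0 le1 le2 le3 => q *; split; apply/andP; split; lra.
have /andP[e_gt0 _] := ed.
pose U : set R := `]xi - e, xi + e[.
have oU : open U by exact: interval_open.
have Uxi : U xi by rewrite /U /= in_itv /=; apply/andP; split; lra.
have rU : regular_open_interval a0 a1 b0 b1 w U.
  split => //; [exact: interval_is_interval|by exists xi|].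
  move=> y; rewrite /U /= in_itv /= => /andP[y1 y2]; apply: hd.
  by move: ed => /andP[_ ed]; rewrite /ball /= ltr_norml; apply/andP; split; lra.
have := C2 U rU xi (subset_closure Uxi).
rewrite (smooth_extension_value g0s oU Uxi (ex0 e ee0)).1.
by rewrite (smooth_extension_value g1s oU Uxi (ex1 e ee1)).2.
Qed.

Lemma cof_ge n f xi k : (n <= k)%N -> cof n f xi k = 0.
Proof. by move=> nk; rewrite /cof ltnNge nk. Qed.

(** With N = n + 1, the bounds by [n + 4] say M < N + 4, and [k = n + 4] is the top order of phi''''
    = D^(n+5) f. Each product converges along the tests for (xi, k), so the equation yields one
    scalar identity. *)
Lemma ode_no_jump (a0 a1 b0 b1 phi : functional R) (w : R[i])
  (p0 p1 q0 q1 n : nat) f xi :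
  classA a0 -> classA a1 -> classA b0 -> classA b1 ->
  (forall x, singular_set a0 a1 b0 b1 w x -> left_value a0 x + right_value a1 x != 0) ->
  (forall U : set R, regular_open_interval a0 a1 b0 b1 w U ->
    forall x : R, closure U x -> smooth_extension a0 U x + smooth_extension a1 U x != 0) ->
  is_derivative_of_regular p0 (Dn 2 a0) -> is_derivative_of_regular p1 (Dn 2 a1) ->
  is_derivative_of_regular q0 b0 -> is_derivative_of_regular q1 b1 ->
  (p0 <= n + 4)%N -> (p1 <= n + 4)%N -> (q0 <= n + 4)%N -> (q1 <= n + 4)%N ->
  piecewise_smooth f -> phi = Dn n.+1 (regular f) -> ode_lhs a0 a1 b0 b1 w phi = 0 ->
  jump f xi = 0.
Proof.
move=> [f0 [n0 [/piecewise_smoothP[s0 _ fs0] E0]]] [f1 [n1 [/piecewise_smoothP[s1 _ fs1] E1]]].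
move=> [g0 [m0 [/piecewise_smoothP[r0 _ gs0] D0]]] [g1 [m1 [/piecewise_smoothP[r1 _ gs1] D1]]].
move=> C1 C2 [h0 [hl0 H0]] [h1 [hl1 H1]] [k0 [kl0 K0]] [k1 [kl1 K1]] p0n p1n q0n q1n.
move=> /piecewise_smoothP[sf _ fs] Ephi ode0.
(* One list for all five functions; [xi] is added so that coefficients can be read there even if
   every function is smooth at [xi]. *)
pose s := undup (xi :: s0 ++ s1 ++ r0 ++ r1 ++ sf).
have us : uniq s by exact: undup_uniq.
have xis : xi \in s by rewrite mem_undup mem_head.
have sub r : {subset r <= s0 ++ s1 ++ r0 ++ r1 ++ sf} -> {subset r <= s}.
  by move=> rs z /rs zs; rewrite mem_undup in_cons zs orbT.
have {}fs0 : pws s f0 by apply: pws_sub fs0; apply: sub => z zs; rewrite !mem_cat zs ?orbT.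
have {}fs1 : pws s f1 by apply: pws_sub fs1; apply: sub => z zs; rewrite !mem_cat zs ?orbT.
have {}gs0 : pws s g0 by apply: pws_sub gs0; apply: sub => z zs; rewrite !mem_cat zs ?orbT.
have {}gs1 : pws s g1 by apply: pws_sub gs1; apply: sub => z zs; rewrite !mem_cat zs ?orbT.
have {}fs : pws s f by apply: pws_sub fs; apply: sub => z zs; rewrite !mem_cat zs ?orbT.
(* [m] only has to bound [k + 1] and the number of derivatives in every factor of the equation. *)
pose m := (n0 + n1 + m0 + m1 + n + 10)%N; pose k := (n + 4)%N.
have km : (k < m)%N by rewrite /k /m; lia.
have [tt [t1 t2 t3]] := coef_tests k xi.
have vanish l (h : R -> R[i]) p r : pws s h -> (l <= m)%N -> is_derivative_of_regular p (Dn l (regular h)) ->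
    (p <= r)%N -> cof l h xi r = 0.
  move=> hs lm [h' [hl' E]] pr; have [lr|rl] := leqP l r; first exact: cof_ge.
  apply: (coef_vanish us xis (leq_trans rl lm) (pws_derivC l hs) _ hl' pr).
  by rewrite -Dn_nf.
have A0 i j : (i <= 2)%N -> (k <= j)%N -> cof (i + n0) f0 xi j = 0.
  move=> i2 kj; apply: (@cof_vanish _ _ _ _ p0 _ i j i2 (leq_trans p0n kj)) => r pr.
  apply: (vanish _ _ p0 r fs0) => //; first by rewrite /m; lia.
  by exists h0; split => //; rewrite -Dn_Dn -E0.
have A1 i j : (i <= 2)%N -> (k <= j)%N -> cof (i + n1) f1 xi j = 0.
  move=> i2 kj; apply: (@cof_vanish _ _ _ _ p1 _ i j i2 (leq_trans p1n kj)) => r pr.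
  apply: (vanish _ _ p1 r fs1) => //; first by rewrite /m; lia.
  by exists h1; split => //; rewrite -Dn_Dn -E1.
have B0 j : (k <= j)%N -> cof m0 g0 xi j = 0.
  move=> kj; apply: (vanish _ _ q0 j gs0 _ _ (leq_trans q0n kj)); first by rewrite /m; lia.
  by exists k0; split => //; rewrite -D0.
have B1 j : (k <= j)%N -> cof m1 g1 xi j = 0.
  move=> kj; apply: (vanish _ _ q1 j gs1 _ _ (leq_trans q1n kj)); first by rewrite /m; lia.
  by exists k1; split => //; rewrite -D1.
(* For l <= 4 at most k + 1 derivatives fall on [f], so no coefficient of order above [k] arises. *)
have P l j : (l <= 4)%N -> (k < j)%N -> cof (l + n.+1) f xi j = 0.
  by move=> l4 kj; apply: cof_ge; move: kj; rewrite /k; lia.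
have term (la lb : nat) (fa fb : R -> R[i]) : (la <= m)%N -> (lb <= m)%N -> pws s fa -> pws s fb ->
    (forall j, (k < j)%N -> cof la fa xi j = 0) -> (forall j, (k < j)%N -> cof lb fb xi j = 0) ->
    ccvg \oo (fun i => star (Dn la (regular fa)) (Dn lb (regular fb)) (tt i))
      (cof la fa xi k * rval (derivC lb fb) xi + cof lb fb xi k * lval (derivC la fa) xi).
  move=> lam lbm fas fbs va vb.
  rewrite (Dn_nf us fas lam) (Dn_nf us fbs lbm).
  rewrite (star_nf _ _ _ (pws_derivC la fas) (pws_derivC lb fbs)) -(star_coef_top _ _ km va vb).
  exact: (nf_tests_cvg t1 t2 t3 _ us xis km (pwsM (pws_derivC la fas) (pws_derivC lb fbs))).
pose c i := cof (4 - i + n.+1) f xi k.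
have L0 (i : 'I_3) : ccvg \oo (fun r => star (Dn i a0) (Dn (4 - i) phi) (tt r))
    (c i * lval (derivC (i + n0) f0) xi).
  have i2 : (i <= 2)%N by rewrite -ltnS.
  have := term (i + n0)%N (4 - i + n.+1)%N f0 f _ _ fs0 fs
    (fun j kj => A0 i j i2 (ltnW kj)) (fun j => P (4 - i)%N j (leq_subr _ _)).
  by rewrite (A0 i k i2 (leqnn k)) mul0r add0r E0 Ephi !Dn_Dn; apply; rewrite /m; lia.
have L1 (i : 'I_3) : ccvg \oo (fun r => star (Dn (4 - i) phi) (Dn i a1) (tt r))
    (c i * rval (derivC (i + n1) f1) xi).
  have i2 : (i <= 2)%N by rewrite -ltnS.
  have := term (4 - i + n.+1)%N (i + n1)%N f f1 _ _ fs fs1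
    (fun j => P (4 - i)%N j (leq_subr _ _)) (fun j kj => A1 i j i2 (ltnW kj)).
  by rewrite (A1 i k i2 (leqnn k)) mul0r addr0 E1 Ephi !Dn_Dn; apply; rewrite /m; lia.
have Pk : cof n.+1 f xi k = 0 by apply: cof_ge; rewrite /k; lia.
have Pk' j : (k < j)%N -> cof n.+1 f xi j = 0 by exact: (P 0%N j).
have L2 : ccvg \oo (fun r => star b0 phi (tt r)) 0.
  have := term m0 n.+1 g0 f _ _ gs0 fs (fun j kj => B0 j (ltnW kj)) Pk'.
  rewrite (B0 k (leqnn k)) Pk !mul0r addr0 -D0 -Ephi; apply; rewrite /m; lia.
have L3 : ccvg \oo (fun r => star phi b1 (tt r)) 0.
  have := term n.+1 m1 f g1 _ _ fs gs1 Pk' (fun j kj => B1 j (ltnW kj)).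
  rewrite (B1 k (leqnn k)) Pk !mul0r addr0 -D1 -Ephi; apply; rewrite /m; lia.
have lim : ccvg \oo (fun r => ode_lhs a0 a1 b0 b1 w phi (tt r))
    (\sum_(i < 3) 'C(2, i)%:R * (c i * lval (derivC (i + n0) f0) xi +
       c i * rval (derivC (i + n1) f1) xi) - w ^+ 2 * (0 + 0)).
  under eq_fun do rewrite ode_lhsE.
  apply: ccvgD.
    apply: ccvg_sum => i _; apply: ccvgM; first exact: ccvg_cst.
    by apply: ccvgD; [exact: L0|exact: L1].
  by apply: ccvgN; apply: ccvgM; [exact: ccvg_cst|exact: ccvgD].
have lim0 : ccvg \oo (fun r => ode_lhs a0 a1 b0 b1 w phi (tt r)) 0.
  by rewrite ode0; exact: ccvg_cst.
(* The terms with i = 1, 2 drop out: phi''' and phi'' have too few derivatives to have a coefficient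
   of order [k]. *)
have := ccvg_unique (FF := eventually_filter) lim lim0; rewrite addr0 mulr0 subr0 big_ord_recl big1; last first.
  move=> i _; have -> : c (lift ord0 i) = 0; 
    last by rewrite [X in _ * (X + _)]mul0r [X in _ * (_ + X)]mul0r addr0 mulr0.
  by apply: cof_ge; rewrite lift0 /k; lia.
rewrite addr0 bin0 mul1r -mulrDr => /eqP; rewrite mulf_eq0 => /orP[|K0'].
  (* For i = 0 the jump is that of the derivative of order (n + 5) - 1 - k = 0, that is, of [f]
     itself. *)
  rewrite /c /cof (_ : (k < 4 - ord0 + n.+1)%N); last by rewrite /k /=; lia.
  rewrite mulf_eq0 signr_eq0 /= (_ : ((4 - 0 + n.+1).-1 - k = 0)%N); last by rewrite /k; lia.
  by rewrite derivC0 => /eqP.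
move: K0'; apply: contraTeq => _.
have n0m : (n0 <= m)%N by rewrite /m; lia.
have n1m : (n1 <= m)%N by rewrite /m; lia.
move: C1 C2; rewrite E0 E1 (Dn_nf us fs0 n0m) (Dn_nf us fs1 n1m) => C1 C2.
exact: (leading_coef_neq0 xi (pws_derivC n0 fs0) (pws_derivC n1 fs1) C1 C2).
Qed.

Lemma ode_reduce (a0 a1 b0 b1 phi : functional R) (w : R[i]) (p0 p1 q0 q1 n : nat) f :
  classA a0 -> classA a1 -> classA b0 -> classA b1 ->
  (forall x, singular_set a0 a1 b0 b1 w x -> left_value a0 x + right_value a1 x != 0) ->
  (forall U : set R, regular_open_interval a0 a1 b0 b1 w U ->
    forall x : R, closure U x -> smooth_extension a0 U x + smooth_extension a1 U x != 0) ->
  is_derivative_of_regular p0 (Dn 2 a0) -> is_derivative_of_regular p1 (Dn 2 a1) ->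
  is_derivative_of_regular q0 b0 -> is_derivative_of_regular q1 b1 ->
  ode_lhs a0 a1 b0 b1 w phi = 0 ->
  piecewise_smooth f -> phi = Dn n (regular f) ->
  exists n' g, [/\ (n' <= maxn (maxn p0 p1) (maxn q0 q1) - 4)%N, piecewise_smooth g &
    phi = Dn n' (regular g)].
Proof.
move=> A0 A1 B0 B1 C1 C2 P0 P1 Q0 Q1 ode0.
elim: n f => [|n IH] f pf Ef; first by exists 0%N, f.
(* Truncated subtraction covers both cases of the theorem: above M - 4 the count n + 1 satisfies M
   <= n + 4, which is what [ode_no_jump] asks for, and for M <= 4 the descent reaches 0. *)
have [nM|Mn] := leqP n.+1 (maxn (maxn p0 p1) (maxn q0 q1) - 4); first by exists n.+1, f.
have J0 x : jump f x = 0.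
  by apply: (ode_no_jump x A0 A1 B0 B1 C1 C2 P0 P1 Q0 Q1 _ _ _ _ pf Ef ode0);
    move: Mn; lia.
apply: (IH (derivC 1 f)); last exact: no_jump_reduce.
have [s _ fs] := piecewise_smoothP pf.
exact: pws_piecewise_smooth (pws_derivC 1 fs).
Qed.

End NoJump.

Theorem corollary3p1 (R : realType) (a0 a1 b0 b1 : functional R) (w : R[i])
  (Aa0 : classA a0) (Aa1 : classA a1) (Ab0 : classA b0) (Ab1 : classA b1)
  (C1 : forall xi : R, singular_set a0 a1 b0 b1 w xi ->
    left_value a0 xi + right_value a1 xi != 0)
  (C2 : forall U : set R, regular_open_interval a0 a1 b0 b1 w U ->
    forall x : R, closure U x ->
      smooth_extension a0 U x + smooth_extension a1 U x != 0)
  (p0 p1 q0 q1 M : nat)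
  (ord_a0 : has_ord (Dn 2 a0) p0) (ord_a1 : has_ord (Dn 2 a1) p1)
  (ord_b0 : has_ord b0 q0) (ord_b1 : has_ord b1 q1)
  (defM : M = maxn (maxn p0 p1) (maxn q0 q1)) :
  ((M <= 4)%N -> forall phi : functional R, is_solution a0 a1 b0 b1 w phi ->
     has_ord phi 0 /\ exists f, piecewise_smooth f /\ phi = regular f) /\
  ((4 < M)%N -> forall phi : functional R, is_solution a0 a1 b0 b1 w phi ->
     exists n : nat, has_ord phi n /\ (n <= M - 4)%N).
Proof.
have main phi : is_solution a0 a1 b0 b1 w phi -> exists n g,
    [/\ (n <= M - 4)%N, piecewise_smooth g & phi = Dn n (regular g)].
  move=> [[f [n [pf Ef]]] ode0]; rewrite defM.
  exact: (ode_reduce Aa0 Aa1 Ab0 Ab1 C1 C2 ord_a0.1 ord_a1.1 ord_b0.1 ord_b1.1 ode0 pf Ef).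
have reg n g : piecewise_smooth g -> is_derivative_of_regular n (Dn n (regular g)).
  by move=> /piecewise_smoothP[s _ /pws_locally_integrable hg]; exists g.
split=> [M4|M4] phi /main[n [g [nM pg Eg]]].
  have n0 : n = 0%N by move: nM M4; lia.
  subst n; split; last by exists g.
  by split => // ; rewrite Eg; exact: reg.
(* The descent bounds the derivatives in one representation; the order is the least number over all
   of them. *)
have [m mn hm] : exists2 m, (m <= n)%N & has_ord phi m.
  by apply: ord_le_ex; rewrite Eg; exact: reg.
by exists m; split => //; exact: leq_trans nM.
Qed.
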